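(* Consider ${\rm APP}=\{{\rm APP}_{\infty,d}\}_{d\in\mathbb N}$ in the worst case setting. For the absolute or the normalized error criterion, EXP-QPT for $\Lambda^{\rm all}$ is equivalent to EXP-QPT for $\Lambda^{\rm std}$.
   Context: $\mathbb T^d=[0,1]^d$ is the torus with Lebesgue measure; $\hat f(\mathbf k)=\int f(\mathbf x)e^{-2\pi i\mathbf k\cdot\mathbf x}d\mathbf x$. For each $d$ let $\omega_d:\mathbb Z^d\to(0,\infty)$ with $\sum_{\mathbf k}\omega_d(\mathbf k)^{-2}<\infty$, and $H^{\omega_d}(\mathbb T^d)$ the Hilbert space of $f\in L_2(\mathbb T^d)$ with $\|f\|^2=\sum_{\mathbf k}|\hat f(\mathbf k)|^2\omega_d(\mathbf k)^2<\infty$. ${\rm APP}_{\infty,d}:H^{\omega_d}(\mathbb T^d)\to L_\infty(\mathbb T^d)$ (sup norm), $f\mapsto f$. $\Lambda^{\rm all}$: all continuous linear functionals; $\Lambda^{\rm std}$: point evaluations. $e(n,{\rm APP}_{\infty,d};\Lambda)$: infimum over algorithms $A(f)=\phi(L_1f,\dots,L_nf)$, $L_i\in\Lambda$, $\phi$ arbitrary, of $\sup_{\|f\|\le1}\|f-A(f)\|_\infty$; $e(0,{\rm APP}_{\infty,d})=\sup_{\|f\|\le1}\|f\|_\infty$. $n^\star(\varepsilon,d;\Lambda)=\inf\{n\ge0:e(n,{\rm APP}_{\infty,d};\Lambda)\le\varepsilon{\rm CRI}_d\}$ with ${\rm CRI}_d=1$ (ABS) or $e(0,{\rm APP}_{\infty,d})$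 (NOR). EXP-QPT for $\Lambda$: there exist $C>0$, $t\ge0$ with $n^\star(\varepsilon,d;\Lambda)\le C\exp\big(t(1+\ln d)(1+\ln(\ln\varepsilon^{-1}+1))\big)$ for all $d\in\mathbb N,\varepsilon\in(0,1)$. *)

(* Defs.v *)
From HB Require Import structures.
From mathcomp Require Import all_boot all_order all_algebra.
From mathcomp Require Import all_classical all_reals all_analysis.
From mathcomp Require Import complex.
Set Implicit Arguments. Unset Strict Implicit. Unset Printing Implicit Defensive.
Import Order.TTheory GRing.Theory Num.Theory.
Import numFieldNormedType.Exports.
Local Open Scope classical_set_scope.
Local Open Scope ring_scope.

Inductive info_class := Lall | Lstd.
Inductive criterion := ABS | NOR.

Section Approx.
Variable R : realType.

Definition Zd (d : nat) := {ffun 'I_d -> int}.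
(* points of R^d; the torus T^d = [0,1]^d is the unit cube below *)
Definition Pt (d : nat) := 'I_d -> R.
(* an element of H^{omega_d} is represented by its Fourier coefficients *)
Definition Coef (d : nat) := Zd d -> R[i].

Definition unit_cube d : set (Pt d) := [set x | forall i, 0 <= x i <= 1].

Definition dotk d (k : Zd d) (x : Pt d) : R := \sum_(i < d) (k i)%:~R * x i.

Definition ek d (k : Zd d) (x : Pt d) : R[i] :=
  Complex (cos (2 * pi * dotk k x)) (sin (2 * pi * dotk k x)).

(* sum of an (absolutely summable) family of complex numbers over an
   arbitrary index type, via positive/negative parts of real and
   imaginary parts *)
Definition psum (I : choiceType) (a : I -> R) : R :=
  fine (\esum_(i in [set: I]) (Num.max (a i) 0)%:E)
  - fine (\esum_(i in [set: I]) (Num.max (- a i) 0)%:E).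
Definition csum (I : choiceType) (a : I -> R[i]) : R[i] :=
  Complex (psum (fun i => complex.Re (a i))) (psum (fun i => complex.Im (a i))).

Definition fval d (c : Coef d) (x : Pt d) : R[i] := csum (fun k => c k * ek k x).

Definition Hnorm2 d (w : Zd d -> R) (c : Coef d) : \bar R :=
  \esum_(k in [set: Zd d]) (Normc.normc (c k) ^+ 2 * w k ^+ 2)%:E.
Definition inH d (w : Zd d -> R) (c : Coef d) : Prop := (Hnorm2 w c < +oo)%E.
Definition Hnorm d (w : Zd d -> R) (c : Coef d) : R := Num.sqrt (fine (Hnorm2 w c)).

Definition lebesgue_null d (N : set (Pt d)) : Prop :=
  forall eps : R, 0 < eps -> exists a b : nat -> Pt d,
    (forall j i, a j i <= b j i) /\
    N `<=` \bigcup_j [set x | forall i, a j i <= x i <= b j i] /\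
    (\sum_(0 <= j <oo) (\prod_(i < d) (b j i - a j i))%:E < eps%:E)%E.

Definition ess_sup_T d (h : Pt d -> R) : \bar R :=
  ereal_inf [set M : \bar R | lebesgue_null [set x | unit_cube x /\ (M < (h x)%:E)%E]].

Definition Hball d (w : Zd d -> R) : set (Coef d) := [set c | (Hnorm2 w c <= 1)%E].

Definition is_cont_linear d (w : Zd d -> R) (L : Coef d -> R[i]) : Prop :=
  (forall (a : R[i]) (c1 c2 : Coef d), inH w c1 -> inH w c2 ->
      L (fun k => a * c1 k + c2 k) = a * L c1 + L c2) /\
  exists M : R, forall c, inH w c -> Normc.normc (L c) <= M * Hnorm w c.

Definition is_point_eval d (w : Zd d -> R) (L : Coef d -> R[i]) : Prop :=
  exists2 x, unit_cube x & forall c, inH w c -> L c = fval c x.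

Definition admissible d (w : Zd d -> R) (Lam : info_class) (L : Coef d -> R[i]) :=
  match Lam with Lall => is_cont_linear w L | Lstd => is_point_eval w L end.

Definition wc_err d (w : Zd d -> R) n (Ls : 'I_n -> Coef d -> R[i])
    (phi : ('I_n -> R[i]) -> Pt d -> R[i]) : \bar R :=
  ereal_sup [set ess_sup_T (fun x => Normc.normc (fval c x - phi (fun i => Ls i c) x))
            | c in Hball w].

Definition min_err d (w : Zd d -> R) (Lam : info_class) (n : nat) : \bar R :=
  ereal_inf [set wc_err w p.1 p.2 | p in
    [set p : ('I_n -> Coef d -> R[i]) * (('I_n -> R[i]) -> Pt d -> R[i])
      | forall i, admissible w Lam (p.1 i)]].

Definition init_err d (w : Zd d -> R) : \bar R :=
  ereal_sup [set ess_sup_T (fun x => Normc.normc (fval c x)) | c in Hball w].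

Definition CRI d (w : Zd d -> R) (cr : criterion) : \bar R :=
  match cr with ABS => 1%E | NOR => init_err w end.

(* information complexity n^*(eps, d; Lambda) (in \bar R, +oo if no n works) *)
Definition nstar d (w : Zd d -> R) (Lam : info_class) (cr : criterion) (eps : R)
  : \bar R :=
  ereal_inf [set (n%:R)%:E | n in [set n : nat |
     (min_err w Lam n <= eps%:E * CRI w cr)%E]].

Definition EXP_QPT (w : forall d : nat, Zd d -> R) (Lam : info_class)
    (cr : criterion) : Prop :=
  exists C t : R, 0 < C /\ 0 <= t /\
    forall d : nat, (0 < d)%N -> forall eps : R, 0 < eps < 1 ->
      (nstar (w d) Lam cr eps <=
        (C * expR (t * (1 + ln d%:R) * (1 + ln (ln eps^-1 + 1))))%:E)%E.

End Approx.

(* Main.v *)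
(* Write l_k = w(k)^-2.  If n linear functionals give error < eta, then any f in the unit
   ball on which they all vanish satisfies |f| <= eta, since f and -f have the same information.
   Taking f along an orthonormal basis of the kernel of the information and averaging over the
   torus gives a set G of n frequencies with sum_{k notin G} l_k <= eta^2.

   Conversely put N = n + 1, rho = eta^2 / N and gam_k = 1 / (1 + rho w(k)^2), so that
   sum_k gam_k <= 2 N.  A second moment argument yields m = 16 N^2 points for which
     sum_k |c_k|^2 <= (1/m) sum_l |f_c(x_l)|^2 + (1/2) sum_k |c_k|^2 / gam_k.
   If f = f_c is a difference of two elements of the ball with the same samples this gives
   sum_k |c_k|^2 = O(rho), and Cauchy-Schwarz on G and off G gives |f| = O(eta).  Hence O(n^2)
   samples lose only a constant factor in the error, which EXP-QPT absorbs.  Frequencies are cut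
   to a finite set carrying all but rho of the total weight, so that averages over the torus
   become averages over a finite grid. *)
Require Import Defs.
From HB Require Import structures.
From mathcomp Require Import all_boot all_order all_algebra.
From mathcomp Require Import all_classical all_reals all_analysis.
From mathcomp Require Import measurable_realfun complex ring lra.
Set Implicit Arguments. Unset Strict Implicit. Unset Printing Implicit Defensive.
Import Order.TTheory GRing.Theory Num.Theory.
Import numFieldNormedType.Exports.
Local Open Scope classical_set_scope.
Local Open Scope ring_scope.

(** * Complex exponentials *)

Section Complex.
Variable R : realType.
Implicit Types (z u : R[i]) (a b t : R).

(** As a real polynomial in the two parts, the squared modulus involves no square root and expands
    freely. *)
Definition sqn z : R := complex.Re z ^+ 2 + complex.Im z ^+ 2.

Lemma sqn_normc z : sqn z = Normc.normc z ^+ 2.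
Proof. by case: z => a b; rewrite /sqn /= sqr_sqrtr // addr_ge0 ?sqr_ge0. Qed.

Lemma sqn_ge0 z : 0 <= sqn z.
Proof. by rewrite addr_ge0 ?sqr_ge0. Qed.

Lemma sqnC z : real_complex R (sqn z) = z * conjc z.
Proof. by case: z => a b; apply/eqP; rewrite eq_complex /sqn /=; apply/andP; split; apply/eqP; ring. Qed.

Lemma sqnM z u : sqn (z * u) = sqn z * sqn u.
Proof. by rewrite !sqn_normc Normc.normcM exprMn. Qed.

Lemma sqnD z u : sqn (z + u) = sqn z + 2 * complex.Re (z * conjc u) + sqn u.
Proof. by case: z u => a b [c d]; rewrite /sqn /=; ring. Qed.

Lemma sqnD_le z u : sqn (z + u) <= 2 * sqn z + 2 * sqn u.
Proof.
case: z u => a b [c d]; rewrite /sqn /=.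
have := sqr_ge0 (a - c); have := sqr_ge0 (b - d); rewrite !sqrrB !sqrrD => h1 h2; lra.
Qed.

Lemma sqnN z : sqn (- z) = sqn z.
Proof. by case: z => a b; rewrite /sqn /= !sqrrN. Qed.

Lemma sqn_real a : sqn (real_complex R a) = a ^+ 2.
Proof. by rewrite /sqn /= expr0n /= addr0. Qed.

Lemma sqn_conj z : sqn (conjc z) = sqn z.
Proof. by case: z => a b; rewrite /sqn /= sqrrN. Qed.

Lemma ler_Re_normc z : `|complex.Re z| <= Normc.normc z.
Proof.
by case: z => a b; rewrite /= -sqrtr_sqr ler_sqrt ?addr_ge0 ?sqr_ge0 // lerDl sqr_ge0.
Qed.

Lemma ler_Im_normc z : `|complex.Im z| <= Normc.normc z.
Proof.
by case: z => a b; rewrite /= -sqrtr_sqr ler_sqrt ?addr_ge0 ?sqr_ge0 // lerDr sqr_ge0.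
Qed.

Lemma normc_ge0 z : 0 <= Normc.normc z.
Proof. by case: z => a b; rewrite /= sqrtr_ge0. Qed.

Lemma normc_le_ReIm z : Normc.normc z <= `|complex.Re z| + `|complex.Im z|.
Proof.
case: z => a b; rewrite -(@ler_pXn2r _ 2) ?nnegrE ?normc_ge0 ?addr_ge0 //.
rewrite -sqn_normc /sqn /= sqrrD !real_normK ?num_real // lerD2r lerDl.
by rewrite mulrn_wge0 // mulr_ge0.
Qed.

Lemma normc_sum (I : Type) (r : seq I) (P : pred I) (F : I -> R[i]) :
  Normc.normc (\sum_(i <- r | P i) F i) <= \sum_(i <- r | P i) Normc.normc (F i).
Proof.
elim/big_rec2: _ => [|i y x _ h]; first by rewrite Normc.normc0.
by apply: le_trans (lerD (lexx _) h); exact: le_normcD.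
Qed.

Lemma Re_sum (I : Type) (r : seq I) (P : pred I) (F : I -> R[i]) :
  complex.Re (\sum_(i <- r | P i) F i) = \sum_(i <- r | P i) complex.Re (F i).
Proof. by apply: (big_morph (@complex.Re R)) => // -[a b] [c d]. Qed.

Lemma Im_sum (I : Type) (r : seq I) (P : pred I) (F : I -> R[i]) :
  complex.Im (\sum_(i <- r | P i) F i) = \sum_(i <- r | P i) complex.Im (F i).
Proof. by apply: (big_morph (@complex.Im R)) => // -[a b] [c d]. Qed.

Lemma Re_realM a z : complex.Re (real_complex R a * z) = a * complex.Re z.
Proof. by case: z => c d /=; rewrite mul0r subr0. Qed.

Definition cexp t : R[i] := Complex (cos (2 * pi * t)) (sin (2 * pi * t)).

Lemma cexpD a b : cexp (a + b) = cexp a * cexp b.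
Proof.
apply/eqP; rewrite eq_complex /= mulrDr cosD sinD eqxx /= addrC.
by apply/eqP; ring.
Qed.

Lemma cexp0 : cexp 0 = 1.
Proof. by rewrite /cexp mulr0 cos0 sin0. Qed.

Lemma cexpN a : cexp (- a) = conjc (cexp a).
Proof. by rewrite /cexp mulrN cosN sinN. Qed.

Lemma cexp_sum (I : Type) (r : seq I) (P : pred I) (F : I -> R) :
  cexp (\sum_(i <- r | P i) F i) = \prod_(i <- r | P i) cexp (F i).
Proof. exact: (big_morph cexp cexpD cexp0). Qed.

Lemma cexpMn a n : cexp (a *+ n) = cexp a ^+ n.
Proof. by elim: n => [|n IH]; rewrite ?cexp0 // mulrS cexpD IH exprS. Qed.

Lemma sqn_cexp t : sqn (cexp t) = 1.
Proof. by rewrite /sqn /= cos2Dsin2. Qed.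

Lemma normc_cexp t : Normc.normc (cexp t) = 1.
Proof. by rewrite /cexp /= cos2Dsin2 sqrtr1. Qed.

Lemma cexp_nat (n : nat) : cexp n%:R = 1.
Proof.
elim: n => [|n IH]; first exact: cexp0.
by rewrite -addn1 natrD cexpD IH mul1r /cexp mulr1 mulr_natl cos2pi sin2pi.
Qed.

Lemma cexp_int (m : int) : cexp m%:~R = 1.
Proof.
case: m => n; first exact: cexp_nat.
by rewrite NegzE rmorphN /= cexpN cexp_nat conjc1.
Qed.

(** The real part differs from 1: cos(2a) - 1 = -2 sin(a)^2, and a = pi t lies strictly between 0
    and pi. *)
Lemma cexp_neq1 t : 0 < t < 1 -> cexp t != 1.
Proof.
move=> /andP[t0 t1]; rewrite eq_complex /= negb_and; apply/orP; left.
have -> : 2 * pi * t = (pi * t) *+ 2 by rewrite -mulr_natl; ring.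
rewrite mulr2n cosD -!expr2 cos2sin2.
rewrite -subr_eq0.
have -> : 1 - sin (pi * t) ^+ 2 - sin (pi * t) ^+ 2 - 1 = - 2 * (sin (pi * t) ^+ 2) by ring.
rewrite mulf_neq0 ?oppr_eq0 ?pnatr_eq0 // expf_neq0 // gt_eqF // sin_gt0_pi //.
by rewrite mulr_gt0 ?pi_gt0 //= gtr_pMr ?pi_gt0.
Qed.

(** The sum is geometric in [z], with z^M = 1, and z is not 1 because 0 < |q|/M < 1; so (z - 1)
    times the sum is z^M - 1 = 0. *)
Lemma cexp_geometric_sum (M : nat) (q : int) : (`|q| < M)%N -> q != 0 ->
  \sum_(j < M) cexp (q%:~R * (j%:R / M%:R)) = 0.
Proof.
move=> qM q0; have M0 : (0 < M)%N by exact: leq_ltn_trans qM.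
have M0r : (0 : R) < M%:R by rewrite ltr0n.
set z := cexp (q%:~R / M%:R).
have z1 : z != 1.
  have qq : 0 < (`|q|%N%:R / M%:R : R) < 1.
    by rewrite divr_gt0 ?ltr0n ?absz_gt0 //= ltr_pdivrMr // mul1r ltr_nat.
  rewrite /z; have := cexp_neq1 qq.
  case: q {z q0 qq} qM => n qM //; rewrite NegzE /= rmorphN /= mulNr cexpN.
  by apply: contra => /eqP /(congr1 (@conjc R)); rewrite conjcK conjc1 => ->.
have zM : z ^+ M = 1.
  by rewrite /z -cexpMn -[X in cexp X]mulr_natr divfK ?gt_eqF // cexp_int.
have -> : \sum_(j < M) cexp (q%:~R * (j%:R / M%:R)) = \sum_(j < M) z ^+ j.
  by apply: eq_bigr => j _; rewrite /z -cexpMn -[X in _ = cexp X]mulr_natr; congr cexp; ring.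
have /eqP := subrX1 z M; rewrite zM subrr eq_sym mulf_eq0 subr_eq0 (negbTE z1) /=.
by move=> /eqP.
Qed.

Lemma conjc_sum (I : Type) (r : seq I) (P : pred I) (F : I -> R[i]) :
  conjc (\sum_(i <- r | P i) F i) = \sum_(i <- r | P i) conjc (F i).
Proof. exact: rmorph_sum. Qed.

Lemma real_complex_sum (I : Type) (r : seq I) (P : pred I) (F : I -> R) :
  real_complex R (\sum_(i <- r | P i) F i) = \sum_(i <- r | P i) real_complex R (F i).
Proof. exact: rmorph_sum. Qed.

Lemma real_complexM a b :
  real_complex R (a * b) = real_complex R a * real_complex R b.
Proof. exact: rmorphM. Qed.

Lemma real_complex_nat n : real_complex R n%:R = n%:R.
Proof. exact: rmorph_nat. Qed.

(** This is |z + s conj(u)|^2 >= 0, expanded and divided by s. *)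
Lemma young_Re z u s : 0 < s -> - (2 * complex.Re (z * u)) <= s * sqn u + sqn z / s.
Proof.
move=> s0; rewrite -(ler_pM2l s0) mulrDr [s * (sqn z / s)]mulrC divfK ?gt_eqF //.
have := sqn_ge0 (z + real_complex R s * conjc u).
have -> : complex.Re (z * u) = (sqn (z + real_complex R s * conjc u) - sqn z - s ^+ 2 * sqn u) / (2 * s).
  rewrite sqnD sqnM sqn_real sqn_conj.
  have -> : complex.Re (z * conjc (real_complex R s * conjc u)) = s * complex.Re (z * u).
    by case: (z) (u) => a b [c e] /=; ring.
  by field; rewrite gt_eqF.
move=> h; set N := sqn (_ + _) in h *.
have -> : s * - (2 * ((N - sqn z - s ^+ 2 * sqn u) / (2 * s))) = sqn z + s ^+ 2 * sqn u - N.
  by field; rewrite gt_eqF.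
by rewrite expr2; lra.
Qed.

End Complex.

(** * Trigonometric polynomials and sampling points *)

Section Grid.
Variables (R : realType) (d : nat).
Implicit Types (z : Zd d) (x : Pt R d).

(** Sums over these M^d equispaced points stand in for integrals over the torus. *)
Definition grid_pt M (g : {ffun 'I_d -> 'I_M}) : Pt R d := fun i => (g i)%:R / M%:R.

Lemma unit_cube_grid_pt M (g : {ffun 'I_d -> 'I_M}) : unit_cube (grid_pt g).
Proof.
move=> i; rewrite /grid_pt divr_ge0 ?ler0n //=.
have M0 : (0 < M)%N by exact: leq_ltn_trans (ltn_ord (g i)).
by rewrite ler_pdivrMr ?ltr0n // mul1r ler_nat ltnW.
Qed.

Lemma ekE (k : Zd d) x : ek k x = cexp (dotk k x).
Proof. by []. Qed.

Lemma ek_sub (k l : Zd d) x : ek (k - l) x = ek k x * conjc (ek l x).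
Proof.
rewrite !ekE -cexpN -cexpD; congr cexp; rewrite /dotk -sumrN -big_split /=.
by apply: eq_bigr => i _; rewrite !ffunE rmorphB /= mulrBl.
Qed.

(** The sum factors over the coordinates, and a coordinate with z_i nonzero contributes a vanishing
    geometric sum. *)
Lemma sum_ek_grid M z : (forall i, `|z i| < M)%N -> z != 0 ->
  \sum_g ek z (@grid_pt M g) = 0.
Proof.
move=> zM z0.
have [i0 zi0] : exists i, z i != 0.
  apply/existsP; apply: contraR z0; rewrite negb_exists => /forallP h.
  by apply/eqP/ffunP => i; rewrite ffunE; apply/eqP; rewrite -[_ == _]negbK h.
under eq_bigr do rewrite ekE /dotk cexp_sum.
rewrite -(bigA_distr_bigA (fun i (j : 'I_M) => cexp ((z i)%:~R * (j%:R / M%:R)))).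
by rewrite (bigD1 i0) //= cexp_geometric_sum // mul0r.
Qed.

Section Frequencies.
Variables (I : finType) (k : I -> Zd d).
Hypothesis k_inj : injective k.

Definition trigpoly (c : I -> R[i]) x : R[i] := \sum_i c i * ek (k i) x.

Lemma sqn_trigpoly c x : real_complex R (sqn (trigpoly c x)) =
  \sum_i \sum_j c i * conjc (c j) * ek (k i - k j) x.
Proof.
rewrite sqnC /trigpoly conjc_sum mulr_suml; apply: eq_bigr => i _.
rewrite mulr_sumr; apply: eq_bigr => j _; rewrite ek_sub rmorphM /=; ring.
Qed.

(** No aliasing: distinct frequencies stay distinct modulo M, so grid averages of squared
    trigonometric polynomials equal their torus averages. *)
Definition grid_separates M := (0 < M)%N /\ forall i j t, (`|(k i - k j)%R t| < M)%N.

Lemma exists_grid_separates : exists M, grid_separates M.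
Proof.
exists (\max_(p : I * I * 'I_d) `|(k p.1.1 - k p.1.2)%R p.2|%N).+1; split=> // i j t.
by rewrite ltnS (leq_bigmax (i, j, t)).
Qed.

Lemma sum_ek_diff M i j : grid_separates M ->
  \sum_g ek (k i - k j) (@grid_pt M g) = (i == j)%:R * #|{ffun 'I_d -> 'I_M}|%:R.
Proof.
move=> [M0 hM]; have [->|ij] := eqVneq i j.
  rewrite subrr mul1r -sumr_const; apply: eq_bigr => g _.
  rewrite ekE /dotk big1 ?cexp0 // => t _.
  by rewrite ffunE mul0r.
by rewrite mul0r sum_ek_grid // subr_eq0 (inj_eq k_inj).
Qed.

Lemma grid_parseval M c : grid_separates M ->
  \sum_g sqn (trigpoly c (@grid_pt M g)) =
  #|{ffun 'I_d -> 'I_M}|%:R * \sum_i sqn (c i).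
Proof.
move=> hM; apply: (@complexI R); rewrite real_complexM !real_complex_sum real_complex_nat.
under eq_bigr do rewrite sqn_trigpoly.
rewrite exchange_big /= mulr_sumr; apply: eq_bigr => i _.
rewrite exchange_big /= (bigD1 i) //= [X in _ + X]big1 => [|j ji].
  by rewrite addr0 -mulr_sumr sum_ek_diff // eqxx mul1r -sqnC mulrC.
by rewrite -mulr_sumr sum_ek_diff // eq_sym (negbTE ji) mul0r mulr0.
Qed.

Variable gam : I -> R.
Hypothesis gam_gt0 : forall i, 0 < gam i.

(** The squared Hilbert-Schmidt norm of the off-diagonal part of the Gram matrix of the sampled
    exponentials, each scaled by sqrt(gam). *)
Let energy m (p : nat -> Pt R d) : R :=
  \sum_i \sum_(j | j != i) gam i * gam j * sqn (\sum_(l < m) ek (k i - k j) (p l)).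

(* Averaging over a grid kills the cross terms, so some grid point does not increase them. *)
Lemma greedy_points m : exists p : nat -> Pt R d,
  (forall l, unit_cube (p l)) /\ energy m p <= m%:R * (\sum_i gam i) ^+ 2.
Proof.
have [M hM] := exists_grid_separates; have [M0 _] := hM.
elim: m => [|m [p [pc pQ]]].
  exists (fun _ => grid_pt [ffun => Ordinal M0]); split=> [l|].
    exact: unit_cube_grid_pt.
  rewrite mul0r /energy big1 // => i _; rewrite big1 // => j _.
  by rewrite big_ord0 /sqn /= expr0n addr0 mulr0.
pose S i j := \sum_(l < m) ek (k i - k j) (p l).
pose cross x := \sum_i \sum_(j | j != i)
  real_complex R (gam i * gam j) * (S i j * conjc (ek (k i - k j) x)).
have cross0 : \sum_g cross (@grid_pt M g) = 0.
  rewrite exchange_big big1 // => i _; rewrite exchange_big big1 // => j ji.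
  rewrite -mulr_sumr -mulr_sumr -conjc_sum sum_ek_diff // eq_sym (negbTE ji).
  by rewrite mul0r conjc0 !mulr0.
have [g hg] : exists g, complex.Re (cross (@grid_pt M g)) <= 0.
  apply/not_existsP => h.
  have : 0 < \sum_g complex.Re (cross (@grid_pt M g)).
    rewrite (bigD1 [ffun => Ordinal M0]) //= ltr_wpDr //.
      by apply: sumr_ge0 => g _; rewrite ltW // ltNge; apply/negP/h.
    by rewrite ltNge; apply/negP/h.
  by rewrite -Re_sum cross0 ltxx.
exists (fun l => if (l < m)%N then p l else grid_pt g); split=> [l|].
  by case: ifP => _; [exact: pc | exact: unit_cube_grid_pt].
rewrite -addn1 natrD mulrDl mul1r.
(* Adding one point expands |S + e|^2 with |e| = 1: old energy, cross term, and a constant bounded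
   by the squared sum of [gam]. *)
have -> : energy (m + 1)%N (fun l => if (l < m)%N then p l else grid_pt g) =
  energy m p + 2 * complex.Re (cross (grid_pt g)) + \sum_i \sum_(j | j != i) gam i * gam j.
  rewrite /energy /cross Re_sum mulr_sumr -!big_split /=; apply: eq_bigr => i _.
  rewrite Re_sum mulr_sumr -!big_split /=; apply: eq_bigr => j _.
  rewrite addn1 big_ord_recr /= ltnn; under eq_bigr do rewrite ltn_ord.
  by rewrite sqnD -/(S i j) Re_realM ekE sqn_cexp; ring.
apply: lerD; first by rewrite -[leRHS]addr0 lerD // mulr_ge0_le0.
rewrite expr2 mulr_suml; apply: ler_sum => i _; rewrite mulr_sumr.
rewrite [leRHS](bigID (fun j => j != i)) /= lerDl sumr_ge0 // => j _.
by rewrite mulr_ge0 // ltW.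
Qed.

(** Expanding the squares, the diagonal gives exactly m times the sum of |c_i|^2. The off-diagonal
    part is controlled by the energy of greedy points, which is at most m^2/4 under the
    hypothesis. *)
Lemma discretization m : 4 * (\sum_i gam i) ^+ 2 <= m%:R ->
  exists p : nat -> Pt R d, (forall l, unit_cube (p l)) /\
  forall c, m%:R * \sum_i sqn (c i) <=
    \sum_(l < m) sqn (trigpoly c (p l)) + m%:R / 2 * \sum_i sqn (c i) / gam i.
Proof.
move=> hm; have [p [pc pQ]] := greedy_points m; exists p; split=> // c.
have [->|m0] := eqVneq m 0%N; first by rewrite big_ord0 !mul0r addr0.
have {m0} m0 : (0 : R) < m%:R by rewrite ltr0n lt0n.
set X := \sum_i sqn (c i) / gam i.
have term_ge0 i : 0 <= sqn (c i) / gam i by rewrite divr_ge0 ?sqn_ge0 // ltW.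
have X0 : 0 <= X by apply: sumr_ge0 => i _.
(* The Young parameter below is proportional to [X], so X = 0, where all coefficients vanish, is
   treated apart. *)
have [X00|Xn0] := eqVneq X 0.
  have c0 i : sqn (c i) = 0.
    have /eqP := X00; rewrite psumr_eq0 // => /allP /(_ i (mem_index_enum _)) /=.
    by rewrite mulf_eq0 invr_eq0 (gt_eqF (gam_gt0 i)) orbF => /eqP.
  by rewrite big1 // mulr0 X00 mulr0 addr0 sumr_ge0 // => l _; exact: sqn_ge0.
have {Xn0} X1 : 0 < X by rewrite lt_def Xn0.
pose S i j := \sum_(l < m) ek (k i - k j) (p l).
pose W i j := complex.Re (c i * conjc (c j) * S i j).
have expand : \sum_(l < m) sqn (trigpoly c (p l)) =
    m%:R * (\sum_i sqn (c i)) + \sum_i \sum_(j | j != i) W i j.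
  have -> : \sum_(l < m) sqn (trigpoly c (p l)) =
      complex.Re (\sum_(l < m) real_complex R (sqn (trigpoly c (p l)))) by rewrite Re_sum.
  under eq_bigr do rewrite sqn_trigpoly.
  rewrite exchange_big /= Re_sum mulr_sumr -big_split /=; apply: eq_bigr => i _.
  rewrite exchange_big /= Re_sum (bigD1 i) //=; congr (_ + _).
    under eq_bigr => l _.
      rewrite -sqnC subrr ekE /dotk big1 ?cexp0 ?mulr1; last by move=> t _; rewrite ffunE mul0r.
      over.
    by rewrite -real_complex_sum sumr_const card_ord mulr_natl.
  by apply: eq_bigr => j _; rewrite /W /S mulr_sumr.
rewrite expand -addrA lerDl.
suff : - (2 * \sum_i \sum_(j | j != i) W i j) <= m%:R * X by lra.
(* Young with parameter s gam_i gam_j on each pair sums to at most s times the energy plus X^2/s;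
   this [s] makes both parts at most mX/2. *)
pose s := 2 * X / m%:R.
have s0 : 0 < s by rewrite divr_gt0 // mulr_gt0.
apply: (@le_trans _ _ (s * energy m p + X ^+ 2 / s)).
  rewrite [X ^+ 2]expr2 mulr_sumr -sumrN /energy mulr_sumr {1}/X !mulr_suml -big_split /=.
  apply: ler_sum => i _.
  rewrite mulr_sumr -sumrN [s * _]mulr_sumr.
  apply: (@le_trans _ _ (\sum_(j | j != i) (s * (gam i * gam j * sqn (S i j)) +
      sqn (c i) / gam i * (sqn (c j) / gam j) / s))).
    apply: ler_sum => j _; have g0 : 0 < s * (gam i * gam j) by rewrite mulr_gt0 // mulr_gt0.
    have := young_Re (c i * conjc (c j)) (S i j) g0; rewrite sqnM sqn_conj.
    have -> : sqn (c i) / gam i * (sqn (c j) / gam j) / s =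
        sqn (c i) * sqn (c j) / (s * (gam i * gam j)).
      by field; rewrite !gt_eqF.
    by rewrite [s * (_ * _ * _)]mulrA mulrA.
  rewrite big_split /= lerD2l -mulr_suml ler_pM2r ?invr_gt0 // -mulr_sumr ler_wpM2l //.
  by rewrite /X [leRHS](bigID (fun j => j != i)) /= lerDl sumr_ge0.
have -> : m%:R * X = s * (m%:R ^+ 2 / 4) + X ^+ 2 / s.
  by rewrite /s; field; rewrite !gt_eqF.
rewrite lerD2r ler_pM2l // (le_trans pQ) // -mulrA expr2 ler_pM2l //; lra.
Qed.

End Frequencies.
End Grid.

(** * Absolutely convergent Fourier series *)

Section Sums.
Variables (R : realType) (T : choiceType) (I : finType) (k : I -> T).
Hypothesis k_inj : injective k.

Lemma esum_fin (f : I -> \bar R) : (forall i, 0 <= f i)%E ->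
  (\esum_(i in [set: I]) f i = \sum_i f i)%E.
Proof.
move=> f0; rewrite esum_fset //; last exact: finite_finset.
rewrite (fsbigE (index_enum I)) ?index_enum_uniq // => [|i].
  by apply: eq_bigl => i; rewrite in_setT.
by rewrite /= mem_index_enum.
Qed.

Lemma esum_split (g : T -> \bar R) : (forall t, 0 <= g t)%E ->
  (\esum_(t in [set: T]) g t = \sum_i g (k i) + \esum_(t in ~` range k) g t)%E.
Proof.
move=> g0; rewrite (esumID (range k)) // !setTI; congr (_ + _)%E.
rewrite esum_image ?esum_fin // => i j _ _; exact: k_inj.
Qed.

Lemma esumZ (A : set T) (g : T -> R) (s : R) : 0 <= s -> (forall t, 0 <= g t) ->
  (\esum_(t in A) (s * g t)%:E = s%:E * \esum_(t in A) (g t)%:E)%E.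
Proof.
move=> s0 g0; apply/eqP; rewrite eq_le; apply/andP; split.
  apply: ge_ereal_sup => _ [X [finX XA] <-].
  rewrite (eq_fsbigr (fun t => s%:E * (g t)%:E)%E) //.
  rewrite -ge0_mule_fsumr; last by move=> t; rewrite lee_fin.
  by apply: lee_wpmul2l; rewrite ?lee_fin //; apply: esum_ge; exists X.
have [->|sn0] := eqVneq s 0.
  by rewrite mul0e esum_ge0 // => t _; rewrite mul0r.
have {sn0} s1 : 0 < s by rewrite lt_def sn0.
rewrite muleC -lee_pdivlMr //; apply: ge_ereal_sup => _ [X [finX XA] <-].
rewrite lee_pdivlMr // ge0_mule_fsuml; last by move=> t; rewrite lee_fin.
by apply: esum_ge; exists X => //; apply: lee_fsum => // t _; rewrite -EFinM mulrC.
Qed.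

(** The tails of the positive and negative parts both lie between 0 and the tail of [b], hence so
    does the absolute value of their difference. *)
Lemma psum_approx (a b : T -> R) :
  (forall t, `|a t| <= b t) -> (\esum_(t in [set: T]) (b t)%:E < +oo)%E ->
  `|psum a - \sum_i a (k i)| <= fine (\esum_(t in ~` range k) (b t)%:E).
Proof.
move=> ab boo.
have b0 t : 0 <= b t by rewrite (le_trans _ (ab t)).
have tail_fin (g : T -> R) : (forall t, 0 <= g t <= b t) ->
    (\esum_(t in ~` range k) (g t)%:E)%E \is a fin_num.
  move=> gb; have g0 t : 0 <= g t by have /andP[] := gb t.
  rewrite ge0_fin_numE; last by apply: esum_ge0 => t _; rewrite lee_fin.
  apply: le_lt_trans boo; rewrite [leRHS]esum_split; last by move=> t; rewrite lee_fin.
  apply: le_trans (leeDr _ _); last by apply: sume_ge0 => i _; rewrite lee_fin.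
  by apply: le_esum => t _; rewrite lee_fin; have /andP[] := gb t.
have fineE (g : T -> R) : (forall t, 0 <= g t <= b t) ->
    fine (\esum_(t in [set: T]) (g t)%:E) =
    \sum_i g (k i) + fine (\esum_(t in ~` range k) (g t)%:E).
  move=> gb; have g0 t : 0 <= g t by have /andP[] := gb t.
  rewrite esum_split; last by move=> t; rewrite lee_fin.
  by rewrite sumEFin fineD // tail_fin.
have fine_tail (g : T -> R) : (forall t, 0 <= g t <= b t) ->
    0 <= fine (\esum_(t in ~` range k) (g t)%:E) <= fine (\esum_(t in ~` range k) (b t)%:E).
  move=> gb; have g0 t : 0 <= g t by have /andP[] := gb t.
  rewrite fine_ge0 /=; last by apply: esum_ge0 => t _; rewrite lee_fin.
  apply: fine_le; [exact: tail_fin | by apply: tail_fin => t; rewrite b0 lexx | ].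
  by apply: le_esum => t _; rewrite lee_fin; have /andP[] := gb t.
have pos t : 0 <= Num.max (a t) 0 <= b t.
  by rewrite le_max lexx orbT /= ge_max b0 andbT (le_trans (ler_norm _)).
have neg t : 0 <= Num.max (- a t) 0 <= b t.
  by rewrite le_max lexx orbT /= ge_max b0 andbT (le_trans (ler_norm _)) // normrN.
rewrite /psum (fineE _ pos) (fineE _ neg).
have -> : \sum_i a (k i) = \sum_i Num.max (a (k i)) 0 - \sum_i Num.max (- a (k i)) 0.
  rewrite -sumrB; apply: eq_bigr => i _; have [h|h] := leP 0 (a (k i)).
    by rewrite (max_idPr _) ?subr0 // oppr_le0.
  by rewrite (max_idPl _) ?oppr_ge0 ?ltW // sub0r opprK.
have /andP[p0 p1] := fine_tail _ pos; have /andP[n0 n1] := fine_tail _ neg.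
by rewrite ler_norml; apply/andP; split; lra.
Qed.

(** The factor 2 comes from treating real and imaginary parts separately. *)
Lemma csum_approx (a : T -> R[i]) (b : T -> R) :
  (forall t, Normc.normc (a t) <= b t) -> (\esum_(t in [set: T]) (b t)%:E < +oo)%E ->
  Normc.normc (csum a - \sum_i a (k i)) <= 2 * fine (\esum_(t in ~` range k) (b t)%:E).
Proof.
move=> ab boo; apply: (le_trans (normc_le_ReIm _)).
have eR : complex.Re (csum a - \sum_i a (k i)) =
    psum (fun t => complex.Re (a t)) - \sum_i complex.Re (a (k i)).
  by rewrite -Re_sum; case: (\sum_i _).
have eI : complex.Im (csum a - \sum_i a (k i)) =
    psum (fun t => complex.Im (a t)) - \sum_i complex.Im (a (k i)).
  by rewrite -Im_sum; case: (\sum_i _).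
rewrite eR eI mulrDl mul1r; apply: lerD; apply: psum_approx => // t.
  exact: le_trans (ler_Re_normc _) (ab t).
exact: le_trans (ler_Im_normc _) (ab t).
Qed.

End Sums.

(** * Point evaluation and truncation in the weighted space *)

Section Fval.
Variables (R : realType) (d : nat).
Implicit Types (w : Zd d -> R) (c : Coef R d) (x : Pt R d).

Lemma esum_subset (T : choiceType) (A : set T) (g : T -> R) : (forall t, 0 <= g t) ->
  (\esum_(t in A) (g t)%:E <= \esum_(t in [set: T]) (g t)%:E)%E.
Proof.
move=> g0; rewrite [leRHS](esumID A) ?setTI => [|t _]; last by rewrite lee_fin.
by apply: leeDl; apply: esum_ge0 => t _; rewrite lee_fin.
Qed.

Lemma normc_ek (k : Zd d) x : Normc.normc (ek k x) = 1.
Proof. by rewrite ekE normc_cexp. Qed.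

(** The dominating family |c_t| has tail zero, so the truncation error vanishes. *)
Lemma fval_finite (I : finType) (k : I -> Zd d) c x : injective k ->
  (forall t, ~ range k t -> c t = 0) -> fval c x = trigpoly k (c \o k) x.
Proof.
move=> k_inj c0; apply/eqP; rewrite -subr_eq0; apply/eqP/Normc.eq0_normc.
have b0 : (\esum_(t in ~` range k) (Normc.normc (c t))%:E = 0)%E.
  by apply: esum1 => t /c0 ->; rewrite Normc.normc0.
apply/eqP; rewrite eq_le normc_ge0 andbT.
rewrite -[leRHS](mulr0 2) -[in leRHS](_ : fine (\esum_(t in ~` range k) (Normc.normc (c t))%:E) = 0).
  apply: csum_approx => // [t|]; first by rewrite Normc.normcM normc_ek mulr1.
  rewrite (esum_split k_inj) => [|t]; last by rewrite lee_fin normc_ge0.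
  by rewrite b0 adde0 sumEFin ltry.
by rewrite b0.
Qed.

(** Each |c_t| is at most (s/2) w^-2 + |c_t|^2 w^2 / (2s). With s = h/del both sums contribute at
    most del h / 2 over the tail. *)
Lemma fval_approx (I : finType) (k : I -> Zd d) w c x (del h : R) : injective k ->
  (forall t, 0 < w t) -> (\esum_(t in [set: Zd d]) (w t ^- 2)%:E < +oo)%E ->
  0 < del -> 0 < h -> (\esum_(t in ~` range k) (w t ^- 2)%:E <= (del ^+ 2)%:E)%E ->
  (Hnorm2 w c <= (h ^+ 2)%:E)%E ->
  Normc.normc (fval c x - trigpoly k (c \o k) x) <= 2 * (del * h).
Proof.
move=> k_inj w0 woo del0 h0 tail hc.
pose s := h / del; have s0 : 0 < s by rewrite divr_gt0.
pose u t : R := w t ^- 2; pose v t : R := Normc.normc (c t) ^+ 2 * w t ^+ 2.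
have u0 t : 0 <= u t by rewrite invr_ge0 exprn_ge0 // ltW.
have v0 t : 0 <= v t by rewrite mulr_ge0 // exprn_ge0 ?normc_ge0 // ltW.
pose b t : R := s / 2 * u t + (2 * s)^-1 * v t.
have s1 : 0 <= s / 2 by rewrite divr_ge0 // ltW.
have s2 : 0 <= (2 * s)^-1 by rewrite invr_ge0 mulr_ge0 // ltW.
have bE A : (\esum_(t in A) (b t)%:E = (s / 2)%:E * (\esum_(t in A) (u t)%:E) +
    ((2 * s)^-1)%:E * (\esum_(t in A) (v t)%:E))%E.
  have e1 : ((s / 2)%:E * (\esum_(t in A) (u t)%:E) = \esum_(t in A) (s / 2 * u t)%:E)%E.
    by rewrite esumZ.
  have e2 : (((2 * s)^-1)%:E * (\esum_(t in A) (v t)%:E) = \esum_(t in A) ((2 * s)^-1 * v t)%:E)%E.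
    by rewrite esumZ.
  rewrite e1 e2 -esumD => [|t _|t _]; last 2 first.
  - by rewrite lee_fin; apply: mulr_ge0.
  - by rewrite lee_fin; apply: mulr_ge0.
  by apply: eq_esum => t _.
have voo A : (\esum_(t in A) (v t)%:E <= (h ^+ 2)%:E)%E by apply: le_trans (esum_subset _ v0) hc.
have bt A M : (\esum_(t in A) (u t)%:E <= M%:E)%E ->
    (\esum_(t in A) (b t)%:E <= (s / 2 * M + (2 * s)^-1 * h ^+ 2)%:E)%E.
  move=> hM; rewrite bE EFinD !EFinM; apply: leeD; apply: lee_wpmul2l => //;
    by rewrite lee_fin.
have boo : (\esum_(t in [set: Zd d]) (b t)%:E < +oo)%E.
  have U : (\esum_(t in [set: Zd d]) (u t)%:E)%E \is a fin_num.
    by rewrite ge0_fin_numE // esum_ge0 // => t _; rewrite lee_fin.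
  by rewrite (le_lt_trans (bt _ (fine (\esum_(t in [set: Zd d]) (u t)%:E)%E) _)) ?ltry // fineK.
apply: (le_trans (csum_approx k_inj (b := b) _ boo)).
  move=> t; rewrite Normc.normcM normc_ek mulr1 /b /u /v.
  have wt := w0 t; set n := Normc.normc _.
  have := sqr_ge0 (n * w t - s / w t).
  have -> : (n * w t - s / w t) ^+ 2 =
      2 * s * (s / 2 * w t ^- 2 + (2 * s)^-1 * (n ^+ 2 * w t ^+ 2) - n).
    by field; rewrite !gt_eqF.
  by rewrite pmulr_rge0 ?subr_ge0 // mulr_gt0.
rewrite ler_pM2l // -lee_fin fineK; last first.
  rewrite ge0_fin_numE; last by apply: esum_ge0 => t _; rewrite lee_fin addr_ge0 // mulr_ge0.
  by apply: le_lt_trans boo; apply: esum_subset => t; rewrite addr_ge0 // mulr_ge0.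
apply: (le_trans (bt _ _ tail)); rewrite lee_fin le_eqVlt; apply/orP; left; apply/eqP.
by rewrite /s; field; rewrite !gt_eqF.
Qed.

(** The infinite sum is the supremum of its finite partial sums; the indices of one within [e] of it
    are enumerated by [k]. *)
Lemma exists_finite_tail w (e : R) : (forall t, 0 < w t) ->
  (\esum_(t in [set: Zd d]) (w t ^- 2)%:E < +oo)%E -> 0 < e ->
  exists (K : nat) (k : 'I_K -> Zd d), injective k /\
    (\esum_(t in ~` range k) (w t ^- 2)%:E <= e%:E)%E.
Proof.
move=> w0 woo e0.
have u0 t : 0 <= w t ^- 2 by rewrite invr_ge0 exprn_ge0 // ltW.
have U : (\esum_(t in [set: Zd d]) (w t ^- 2)%:E)%E \is a fin_num.
  by rewrite ge0_fin_numE // esum_ge0 // => t _; rewrite lee_fin.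
have [_ [X [finX _] <-]] := ub_ereal_sup_adherent e0 U.
rewrite -/(esum _ _) => hX; pose s : seq (Zd d) := finmap.enum_fset (fset_set X).
pose k (i : 'I_(size s)) := tnth (in_tuple s) i.
have k_inj : injective k.
  move=> i j /eqP; rewrite /k !(tnth_nth 0) nth_uniq ?finmap.fset_uniq //.
  by move/eqP/val_inj.
exists (size s), k; split=> //.
move: hX; rewrite fsbig_finite // (esum_split k_inj); last by move=> t; rewrite lee_fin.
have -> : (\sum_(t <- finmap.enum_fset (fset_set X)) (w t ^- 2)%:E = \sum_i (w (k i) ^- 2)%:E)%E.
  by rewrite (big_nth 0) big_mkord; apply: eq_bigr => i _; rewrite /k (tnth_nth 0).
rewrite sumEFin; set S := (\sum_i _)%R; set tl := esum _ _.
have : (0 <= tl)%E by apply: esum_ge0 => t _; rewrite lee_fin.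
case: tl => [r _|_|//]; last by rewrite addey // addye.
by rewrite -EFinD -?EFinB -?EFinN -?EFinD lte_fin lee_fin => hX; lra.
Qed.

(** The slack [e] provides the positive norm bound that [fval_approx] asks for, even when the norm
    is zero. *)
Lemma inH_bound w c : inH w c -> forall e : R, 0 < e ->
  (Hnorm2 w c <= ((Hnorm w c + e) ^+ 2)%:E)%E.
Proof.
move=> hc e e0; have H0 : (0 <= Hnorm2 w c)%E.
  by apply: esum_ge0 => t _; rewrite lee_fin mulr_ge0 // sqr_ge0.
have Hf : Hnorm2 w c \is a fin_num by rewrite ge0_fin_numE.
rewrite -(fineK Hf) lee_fin -[leLHS]sqr_sqrtr ?fine_ge0 // -/(Hnorm w c).
by rewrite ler_pXn2r ?nnegrE ?addr_ge0 ?sqrtr_ge0 ?ltW // ltrDl.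
Qed.

Lemma inH_linear w (a : R[i]) c1 c2 : inH w c1 -> inH w c2 ->
  inH w (fun t => a * c1 t + c2 t).
Proof.
rewrite /inH /Hnorm2 => h1 h2.
pose g c t : R := Normc.normc (c t) ^+ 2 * w t ^+ 2.
have g0 c t : 0 <= g c t by rewrite mulr_ge0 // sqr_ge0.
apply: (@le_lt_trans _ _ (\esum_(t in [set: Zd d]) ((2 * sqn a * g c1 t)%:E + (2 * g c2 t)%:E))%E).
  apply: le_esum => t _; rewrite -EFinD lee_fin -sqn_normc.
  have := sqnD_le (a * c1 t) (c2 t); rewrite sqnM /g -!sqn_normc => h.
  have -> : 2 * sqn a * (sqn (c1 t) * w t ^+ 2) + 2 * (sqn (c2 t) * w t ^+ 2) =
    (2 * (sqn a * sqn (c1 t)) + 2 * sqn (c2 t)) * w t ^+ 2 by ring.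
  by rewrite ler_wpM2r // sqr_ge0.
have sa0 : 0 <= 2 * sqn a by rewrite mulr_ge0 // sqn_ge0.
rewrite esumD => [|t _|t _]; last 2 first.
- by rewrite lee_fin mulr_ge0.
- by rewrite lee_fin mulr_ge0.
rewrite !esumZ // ?mulr_ge0 ?sqn_ge0 //.
by apply: lte_add_pinfty; apply: lte_mul_pinfty.
Qed.

(** [csum] splits into signed parts and is not visibly linear, so linearity is read off from
    truncations with arbitrarily small error. *)
Lemma point_eval_cont_linear w (L : Coef R d -> R[i]) : (forall t, 0 < w t) ->
  (\esum_(t in [set: Zd d]) (w t ^- 2)%:E < +oo)%E ->
  is_point_eval w L -> is_cont_linear w L.
Proof.
move=> w0 woo [x xc hL]; split.
  move=> a c1 c2 h1 h2; have h3 := inH_linear a h1 h2.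
  rewrite !hL //; set c3 := (fun t => _) in h3 *.
  apply/eqP; rewrite -subr_eq0; apply/eqP/Normc.eq0_normc/eqP.
  rewrite eq_le normc_ge0 andbT; apply/ler_addgt0Pl => e e0; rewrite addr0.
  pose B := (Hnorm w c3 + 1) + Normc.normc a * (Hnorm w c1 + 1) + (Hnorm w c2 + 1).
  have n1 c : 0 < Hnorm w c + 1 by rewrite ltr_wpDl ?sqrtr_ge0.
  have B0 : 0 < B by rewrite ltr_wpDl // addr_ge0 ?mulr_ge0 ?normc_ge0 // ltW.
  (* Chosen so that the three truncation errors add up to exactly [e]. *)
  pose del := e / (2 * B); have del0 : 0 < del by rewrite divr_gt0 // mulr_gt0.
  have [K [k [k_inj tail]]] := exists_finite_tail w0 woo (exprn_gt0 2 del0).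
  have ap c : inH w c -> Normc.normc (fval c x - trigpoly k (c \o k) x) <=
      2 * (del * (Hnorm w c + 1)).
    by move=> hc; apply: (fval_approx (w := w)) => //; exact: inH_bound.
  have -> : fval c3 x - (a * fval c1 x + fval c2 x) =
      (fval c3 x - trigpoly k (c3 \o k) x) + (- a * (fval c1 x - trigpoly k (c1 \o k) x) +
      - (fval c2 x - trigpoly k (c2 \o k) x)).
    have -> : trigpoly k (c3 \o k) x = a * trigpoly k (c1 \o k) x + trigpoly k (c2 \o k) x.
      by rewrite /trigpoly mulr_sumr -big_split /=; apply: eq_bigr => i _; rewrite /c3 mulrDl mulrA.
    ring.
  have -> : e = 2 * (del * (Hnorm w c3 + 1)) + (Normc.normc a * (2 * (del * (Hnorm w c1 + 1))) +
      2 * (del * (Hnorm w c2 + 1))).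
    by rewrite /del /B; field; rewrite -/B gt_eqF.
  apply: (le_trans (le_normcD _ _)); apply: lerD; first exact: ap.
  apply: (le_trans (le_normcD _ _)); apply: lerD; last by rewrite normcN; exact: ap.
  by rewrite Normc.normcM normcN ler_wpM2l ?normc_ge0 //; exact: ap.
set U := (\esum_(t in _) _)%E in woo.
have U0 : (0 <= U)%E by apply: esum_ge0 => t _; rewrite lee_fin invr_ge0 exprn_ge0 // ltW.
have Uf : U \is a fin_num by rewrite ge0_fin_numE.
(* Then del > 0 and del^2 >= U. *)
pose del := fine U + 1; have del0 : 0 < del by rewrite ltr_wpDl ?fine_ge0.
exists (2 * del) => c hc; rewrite hL //; apply/ler_addgt0Pl => e e0.
(* With no frequency kept, the truncation estimate bounds |f(x)| itself. *)
pose k (i : 'I_0) : Zd d := 0; have k_inj : injective k by case.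
have e1 : 0 < e / (2 * del) by rewrite divr_gt0 // mulr_gt0.
have := @fval_approx _ k w c x del (Hnorm w c + e / (2 * del)) k_inj w0 woo del0.
rewrite /trigpoly big_ord0 subr0 => /(_ _ _ (inH_bound hc e1)) h.
apply: (le_trans (h _ _)); first by rewrite ltr_wpDl ?sqrtr_ge0.
  apply: (le_trans (esum_subset _ _)).
    by move=> t; rewrite invr_ge0 exprn_ge0 // ltW.
  rewrite -/U -(fineK Uf) lee_fin /del sqrrD expr1n mulr1.
  have f0 := fine_ge0 U0; have := sqr_ge0 (fine U); rewrite -mulr_natr; lra.
by rewrite le_eqVlt; apply/orP; left; apply/eqP; field; rewrite gt_eqF.
Qed.

End Fval.

(** * The width bound for arbitrary linear information *)

Section Selection.
Variable R : realType.

(** Greedy choice: the largest value outside the set is added each time and becomes the new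
    threshold. *)
Lemma exists_top_set (K n : nat) (lam : 'I_K -> R) : (n < K)%N -> (forall i, 0 <= lam i) ->
  exists (G : {set 'I_K}) (tau : R), [/\ #|G| = n, 0 <= tau,
    forall i, i \in G -> tau <= lam i & forall i, i \notin G -> lam i <= tau].
Proof.
move=> nK lam0; elim: n nK => [|n IH] nK.
  have i0 : 'I_K := Ordinal nK.
  (* For the empty set the threshold need only dominate every value; the total does. *)
  exists finset.set0, (\sum_i lam i); split=> [||i|i _]; rewrite ?cards0 ?inE ?sumr_ge0 //.
  by rewrite (bigD1 i) //= lerDl sumr_ge0.
have [G [tau [cG tau0 hin hout]]] := IH (ltnW nK).
have [i0 i0G] : exists i, i \notin G.
  apply/existsP; rewrite -negb_forall; apply/negP => /forallP h.
  have : #|G| = K by rewrite -[RHS]card_ord; apply: eq_card => i; rewrite h inE.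
  by rewrite cG => nK'; move: nK; rewrite -nK' ltnNge leqnSn.
pose i1 := [arg max_(i > i0 | i \notin G) lam i]%O.
have [i1G i1max] : i1 \notin G /\ forall j, j \notin G -> lam j <= lam i1.
  by rewrite /i1; case: arg_maxP => // i iG h; split.
exists (i1 |: G), (lam i1); split=> // [|i|i].
- by rewrite cardsU1 i1G cG.
- by rewrite !inE => /orP[/eqP->//|iG]; exact: le_trans (hout _ i1G) (hin _ iG).
- by rewrite !inE negb_or => /andP[_]; exact: i1max.
Qed.

(** With G the n largest values and tau their threshold, (lam_i - tau)(p_i - [i notin G]) >= 0 for
    every i, while the p_i - [i notin G] have nonnegative sum. *)
Lemma sum_outside_top (K n : nat) (lam p : 'I_K -> R) :
  (n <= K)%N -> (forall i, 0 <= lam i) -> (forall i, 0 <= p i <= 1) ->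
  (K - n)%:R <= \sum_i p i ->
  exists G : {set 'I_K}, (#|G| <= n)%N /\ \sum_(i | i \notin G) lam i <= \sum_i lam i * p i.
Proof.
move=> nK lam0 p01 hp.
have lp0 i : 0 <= lam i * p i by rewrite mulr_ge0 //; have /andP[] := p01 i.
move: nK; rewrite leq_eqVlt => /predU1P[->|nK].
  exists finset.setT; rewrite cardsT card_ord; split=> //.
  by rewrite big1 ?sumr_ge0 // => i; rewrite inE.
have [G [tau [cG tau0 hin hout]]] := exists_top_set nK lam0.
exists G; rewrite cG; split=> //; rewrite [leLHS]big_mkcond -subr_ge0 -sumrB /=.
apply: (@le_trans _ _ (\sum_i tau * (p i - (i \notin G)%:R))).
  rewrite -mulr_sumr sumrB mulr_ge0 // subr_ge0 (le_trans _ hp) //.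
  rewrite -natr_sum; rewrite ler_nat leq_eqVlt; apply/orP; left; apply/eqP.
  have -> : (K - n = #|~: G|)%N by rewrite -[RHS](addKn #|G|) cardsC card_ord cG.
  by rewrite -sum1_card [RHS]big_mkcond; apply: eq_bigr => i _; rewrite inE; case: (i \in G).
apply: ler_sum => i _; have /andP[p0 p1] := p01 i.
have [iG|iG] := boolP (i \in G); rewrite /= ?subr0.
  by rewrite ler_wpM2r // hin.
have := hout _ iG; nra.
Qed.

End Selection.

Section Isometry.
Variable R : realType.

(** For a rectangular matrix [unitarymx] means orthonormal rows, which makes u -> uV an isometry. *)
Lemma sqn_unitary (r K : nat) (V : 'M[R[i]]_(r, K)) (u : 'I_r -> R[i]) : V \is unitarymx ->
  \sum_l sqn (\sum_j u j * V j l) = \sum_j sqn (u j).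
Proof.
move=> /unitarymxP /matrixP VV; apply: (@complexI R); rewrite !real_complex_sum.
have VVE j j' : \sum_l (u j * V j l) * conjc (u j' * V j' l) =
    u j * conjc (u j') * (j == j')%:R.
  have := VV j j'; rewrite !mxE => <-; rewrite mulr_sumr; apply: eq_bigr => l _.
  by rewrite !mxE rmorphM /= mulrACA.
under eq_bigr => l _.
  rewrite sqnC conjc_sum mulr_suml; under eq_bigr do rewrite mulr_sumr.
  over.
rewrite exchange_big; apply: eq_bigr => j _; rewrite exchange_big /= (bigD1 j) //=.
rewrite [X in _ + X]big1 ?addr0 => [|j' jj']; first by rewrite VVE eqxx mulr1 sqnC.
by rewrite VVE eq_sym (negbTE jj') mulr0.
Qed.

End Isometry.

Section Width.
Variables (R : realType) (d K n : nat) (k : 'I_K -> Zd d) (w : 'I_K -> R).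
Hypotheses (k_inj : injective k) (w_gt0 : forall i, 0 < w i).

(** The exponentials scaled by [wC] are orthonormal in the weighted space. *)
Let wC i : R[i] := real_complex R (w i)^-1.

Lemma sqn_wC i : sqn (wC i) = w i ^- 2.
Proof. by rewrite sqn_real exprVn. Qed.

(* For an orthonormal basis [V] of the kernel of the information, the sum of the [sqn (V_j(x))] is
   the squared norm of the evaluation at [x] restricted to that kernel; its mean over the torus is
   the trace of the weights compressed to the kernel. *)
Lemma tail_le_of_kernel_bound (A : 'I_K -> 'I_n -> R[i]) (eta : R) :
  (forall c : 'I_K -> R[i], (forall t, \sum_i c i * A i t = 0) ->
    \sum_i sqn (c i) * w i ^+ 2 <= 1 -> forall x, unit_cube x -> sqn (trigpoly k c x) <= eta) ->
  exists G : {set 'I_K}, (#|G| <= n)%N /\ \sum_(i | i \notin G) w i ^- 2 <= eta.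
Proof.
move=> H.
(* If n >= K all frequencies are taken, and eta >= 0 follows from the zero polynomial. *)
have [Kn|nK] := leqP K n.
  exists finset.setT; rewrite cardsT card_ord; split=> //.
  rewrite big1 => [|i]; last by rewrite inE.
  have c0 : \sum_i sqn ((fun=> 0 : R[i]) i) * w i ^+ 2 <= 1 :> R.
    by rewrite big1 ?ler01 // => i _; rewrite /sqn /= expr0n addr0 mul0r.
  have x0 : unit_cube (fun _ : 'I_d => 0 : R) by move=> i; rewrite lexx ler01.
  by apply: le_trans (sqn_ge0 _) (H _ _ c0 _ x0) => t; rewrite big1 // => i _; rewrite mul0r.
(* The information matrix in the orthonormal basis. Its left kernel has dimension at least K - n,
   and Gram-Schmidt turns a basis of it into [V]. *)
pose B : 'M[R[i]]_(K, n) := \matrix_(i, t) (wC i * A i t).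
pose V0 := row_base (kermx B); pose r := \rank (kermx B).
have rK : (r <= K)%N by exact: rank_leq_row.
have Knr : (K - n <= r)%N by rewrite /r mxrank_ker leq_sub2l // rank_leq_col.
pose V : 'M[R[i]]_(r, K) := schmidt V0.
have Vu : V \is unitarymx by exact: schmidt_unitarymx.
have VB : V *m B = 0.
  apply/eqP; rewrite -sub_kermx -(eq_row_base (kermx B)).
  by rewrite (eqmx_schmidt_free (row_base_free _)).
pose v (j : 'I_r) := trigpoly k (fun i => V j i * wC i).
pose p i : R := \sum_j sqn (V j i).
(* The coefficients conj(v_j(x)) / sqrt(S) give the extremal unit vector of the kernel; its value at
   x is sqrt(S). *)
have point x : unit_cube x -> \sum_j sqn (v j x) <= eta.
  move=> xc; set S := \sum_j _; have S0 : 0 <= S by apply: sumr_ge0 => j _; exact: sqn_ge0.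
  have [->|Sn0] := eqVneq S 0.
    by have := sqn_ge0 (trigpoly k (fun=> 0) x) => /le_trans; apply; apply: H => // [t|];
      rewrite big1 ?ler01 // => i _; rewrite ?mul0r // /sqn /= expr0n addr0 mul0r.
  have {Sn0} S1 : 0 < S by rewrite lt_def Sn0.
  pose sg := Num.sqrt S; have sg0 : 0 < sg by rewrite sqrtr_gt0.
  have sg2 : sg ^+ 2 = S by rewrite sqr_sqrtr.
  pose u j : R[i] := conjc (v j x) * real_complex R sg^-1.
  have usum : \sum_j sqn (u j) = 1.
    under eq_bigr do rewrite sqnM sqn_conj sqn_real exprVn sg2.
    by rewrite -mulr_suml divff // gt_eqF.
  pose c i : R[i] := (\sum_j u j * V j i) * wC i.
  have -> : S = sqn (trigpoly k c x).
    have -> : trigpoly k c x = real_complex R sg; last by rewrite sqn_real sg2.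
    transitivity (\sum_j u j * v j x).
      rewrite /trigpoly /c /v /trigpoly; under [RHS]eq_bigr do rewrite mulr_sumr.
      rewrite exchange_big; apply: eq_bigr => i _; rewrite !mulr_suml.
      by apply: eq_bigr => j _; rewrite !mulrA.
    rewrite /u; under eq_bigr do rewrite mulrAC [_ * v _ x]mulrC -sqnC -real_complexM.
    rewrite -real_complex_sum -mulr_suml -/S -sg2; congr (real_complex R _).
    by field; rewrite gt_eqF.
  apply: H => //.
    move=> t; transitivity (\sum_j u j * (V *m B) j t).
      under [RHS]eq_bigr do rewrite mxE mulr_sumr.
      rewrite exchange_big; apply: eq_bigr => i _; rewrite /c !mulr_suml.
      by apply: eq_bigr => j _; rewrite !mxE !mulrA.
    by rewrite big1 // => j _; rewrite VB mxE mulr0.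
  rewrite -usum -(sqn_unitary u Vu) le_eqVlt; apply/orP; left; apply/eqP.
  apply: eq_bigr => i _; rewrite /c sqnM sqn_wC divfK //.
  by rewrite expf_neq0 // gt_eqF.
have [M hM] := exists_grid_separates k; have [M0 _] := hM.
have N0 : (0 : R) < #|{ffun 'I_d -> 'I_M}|%:R.
  by rewrite ltr0n; apply/card_gt0P; exists [ffun => Ordinal M0].
have trace : \sum_i w i ^- 2 * p i <= eta.
  rewrite -(ler_pM2l N0).
  have -> : #|{ffun 'I_d -> 'I_M}|%:R * \sum_i w i ^- 2 * p i =
      \sum_g \sum_j sqn (v j (@grid_pt R d M g)).
    rewrite exchange_big; under [RHS]eq_bigr do rewrite grid_parseval //.
    rewrite -mulr_sumr exchange_big; congr (_ * _); apply: eq_bigr => i _.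
    by rewrite mulr_sumr; apply: eq_bigr => j _; rewrite sqnM sqn_wC mulrC.
  rewrite mulr_natl -sumr_const; apply: ler_sum => g _; apply: point.
  exact: unit_cube_grid_pt.
(* [p i] is a diagonal entry of the orthogonal projection onto the rows of [V], so idempotence gives
   p_i^2 <= p_i. *)
have p01 i : 0 <= p i <= 1.
  have p0 : 0 <= p i by apply: sumr_ge0 => j _; exact: sqn_ge0.
  rewrite p0 /=.
  have := sqn_unitary (fun j => conjc (V j i)) Vu; rewrite (bigD1 i) //=.
  have -> : \sum_j conjc (V j i) * V j i = real_complex R (p i).
    by rewrite real_complex_sum; apply: eq_bigr => j _; rewrite mulrC sqnC.
  under [RHS]eq_bigr do rewrite sqn_conj.
  rewrite sqn_real -/(p i) => e.
  have : p i ^+ 2 <= p i by rewrite -[leRHS]e lerDl sumr_ge0 // => l _; exact: sqn_ge0.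
  by have [//|p1] := leP (p i) 1; nra.
(* The trace of that projection is its rank [r]. *)
have psum : (K - n)%:R <= \sum_i p i.
  rewrite exchange_big (@le_trans _ _ r%:R) ?ler_nat //.
  rewrite -[r in leLHS]card_ord -sumr_const ler_sum // => j _.
  have := sqn_unitary (fun j' => (j' == j)%:R) Vu.
  rewrite [RHS](bigD1 j) //= eqxx [X in _ + X]big1; last first.
    by move=> j' /negbTE ->; rewrite /sqn /= expr0n addr0.
  rewrite /= addr0 [sqn 1]/sqn /= expr1n expr0n addr0 => <-.
  apply: ler_sum => l _; rewrite (bigD1 j) //= eqxx mul1r big1 ?addr0 // => j' /negbTE ->.
  by rewrite mul0r.
have lam0 i : 0 <= w i ^- 2 by rewrite invr_ge0 exprn_ge0 // ltW.
have [G [cG hG]] := sum_outside_top (ltnW nK) lam0 p01 psum.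
exists G; split=> //; exact: le_trans hG trace.
Qed.

End Width.

(** * Null sets *)

Section Boxes.
Variable R : realType.

(** Induction on the dimension reduces countable subadditivity of box volumes to one-dimensional
    Lebesgue measure. The weights make the statement stable under slicing: integration over the
    first coordinate multiplies them by first side lengths. *)
Lemma weighted_box_cover d (a b : 'I_d -> R) (A B : nat -> 'I_d -> R) (c : nat -> R) (v : R) :
  0 <= v -> (forall j, 0 <= c j) -> (forall i, a i <= b i) -> (forall j i, A j i <= B j i) ->
  (forall x : 'I_d -> R, (forall i, a i <= x i <= b i) ->
    (v%:E <= \sum_(0 <= j <oo) (c j * [forall i, A j i <= x i <= B j i]%:R)%:E)%E) ->
  ((v * \prod_i (b i - a i))%:E <= \sum_(0 <= j <oo) (c j * \prod_i (B j i - A j i))%:E)%E.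
Proof.
elim: d a b A B c v => [|d IH] a b A B c v v0 c0 ab AB h.
  rewrite big_ord0 mulr1 (le_trans (h a _)) //; first by case.
  rewrite le_eqVlt; apply/orP; left; apply/eqP/eq_eseriesr => j _.
  by rewrite big_ord0; congr (_ * _)%:E; case: forallP => // -[]; case.
rewrite big_ord_recl mulrA.
have -> : (\sum_(0 <= j <oo) (c j * \prod_i (B j i - A j i))%:E =
  \sum_(0 <= j <oo) ((c j * (B j ord0 - A j ord0)) *
    \prod_i (B j (lift ord0 i) - A j (lift ord0 i)))%:E)%E.
  by apply: eq_eseriesr => j _; rewrite big_ord_recl mulrA.
apply: (IH (fun i => a (lift ord0 i)) (fun i => b (lift ord0 i))
  (fun j i => A j (lift ord0 i)) (fun j i => B j (lift ord0 i))) => //.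
- by rewrite mulr_ge0 // subr_ge0.
- by move=> j; rewrite mulr_ge0 // subr_ge0.
move=> x xab.
pose ext t : 'I_d.+1 -> R := fun i => if unlift ord0 i is Some j then x j else t.
pose w j : R := c j * [forall i, A j (lift ord0 i) <= x i <= B j (lift ord0 i)]%:R.
have w0 j : 0 <= w j by rewrite mulr_ge0.
pose D := `[a ord0, b ord0]%classic : set R.
pose J j := `[A j ord0, B j ord0]%classic : set R.
have mD : measurable D by exact: measurable_itv.
have mJ j : measurable (J j) by exact: measurable_itv.
have mu_itv (u u' : R) : u <= u' -> lebesgue_measure (`[u, u']%classic : set R) = (u' - u)%:E.
  by rewrite lebesgue_measure_itv /= lte_fin le_eqVlt => /predU1P[->|->//]; rewrite ltxx subrr.
have pt t : D t -> (v%:E <= \sum_(0 <= j <oo) ((w j)%:E * (\1_(J j) t)%:E))%E.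
  move=> Dt; apply: le_trans (h (ext t) _) _.
    move=> i; rewrite /ext; case: unliftP => [j ->|->]; first exact: xab.
    by move: Dt; rewrite /D /= in_itv.
  rewrite le_eqVlt; apply/orP; left; apply/eqP/eq_eseriesr => j _.
  rewrite -EFinM /w -mulrA; congr (_ * _)%:E.
  rewrite indicE -natrM mulnb; congr ((_ : bool)%:R).
  apply/forallP/andP => [H|[/forallP H1 H2] i].
    split; last by rewrite inE /J /= in_itv /=; have := H ord0; rewrite /ext unlift_none.
    by apply/forallP => i; have := H (lift ord0 i); rewrite /ext liftK.
  rewrite /ext; case: unliftP => [i' ->|->]; first exact: H1.
  by move: H2; rewrite inE /J /= in_itv.
(* After exchanging integral and series, term j is [w j] times the length of [J j] within [D], at
   most its full side. *)
have : (\int[lebesgue_measure]_(t in D) (cst v%:E t) <=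
  \int[lebesgue_measure]_(t in D) \sum_(0 <= j <oo) ((w j)%:E * (\1_(J j) t)%:E))%E.
  apply: ge0_le_integral => //.
  - apply: ge0_emeasurable_sum => // [j t _ _|j _].
      by rewrite -EFinM lee_fin mulr_ge0.
    apply: emeasurable_funM => //.
    by apply/measurable_EFinP; apply: measurable_indic; exact: mJ.
rewrite [X in (X <= _)%E -> _](_ : _ = (v%:E * lebesgue_measure D)%E); last exact: integral_cst.
rewrite mu_itv // -EFinM => /le_trans; apply.
rewrite integral_nneseries //; last 2 first.
- move=> j; apply: emeasurable_funM => //.
  by apply/measurable_EFinP; apply: measurable_indic; exact: mJ.
- by move=> j t _; rewrite -EFinM lee_fin mulr_ge0.
apply: lee_nneseries => [j _ _|j _].
  by apply: integral_ge0 => t _; rewrite -EFinM lee_fin mulr_ge0.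
rewrite ge0_integralZl_EFin //; last first.
  by apply/measurable_EFinP; apply: measurable_indic; exact: mJ.
rewrite integral_indic //.
have -> : c j * (B j ord0 - A j ord0) * [forall i, A j (lift ord0 i) <= x i <= B j (lift ord0 i)]%:R =
  w j * (B j ord0 - A j ord0) by rewrite /w; ring.
rewrite (EFinM (w j) (B j ord0 - A j ord0)).
apply: lee_wpmul2l; first by rewrite lee_fin.
rewrite -(mu_itv _ _ (AB j ord0)); apply: le_measure; rewrite ?inE.
- by apply: measurableI; [exact: mJ|exact: mD].
- exact: mJ.
- exact: subIsetl.
- exact: mJ.
Qed.

End Boxes.

Section NullSets.
Variables (R : realType) (d : nat).
Implicit Types (x a b : Pt R d).

(** Covers of the two sets, each of volume below half that of the box, would interleave into one
    cover of the box of too small a volume. *)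
Lemma null_sets_contain_no_box (N1 N2 : set (Pt R d)) a b :
  (forall i, a i < b i) -> lebesgue_null N1 -> lebesgue_null N2 ->
  ~ ([set x | forall i, a i <= x i <= b i] `<=` N1 `|` N2).
Proof.
move=> ab n1 n2 sub; pose v := \prod_i (b i - a i).
have v0 : 0 < v by apply: prodr_gt0 => i _; rewrite subr_gt0.
have v2 : 0 < v / 2 by rewrite divr_gt0.
have [A1 [B1 [AB1 [c1 s1]]]] := n1 _ v2; have [A2 [B2 [AB2 [c2 s2]]]] := n2 _ v2.
pose A j := if odd j then A2 j./2 else A1 j./2.
pose B j := if odd j then B2 j./2 else B1 j./2.
have AB j i : A j i <= B j i by rewrite /A /B; case: ifP.
pose vol (A B : nat -> Pt R d) j := \prod_i (B j i - A j i).
have vol0 A' B' : (forall j i, A' j i <= B' j i) -> forall j, (0 <= (vol A' B' j)%:E)%E.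
  by move=> h j; rewrite lee_fin prodr_ge0 // => i _; rewrite subr_ge0.
have : (v%:E <= \sum_(0 <= j <oo) (vol A B j)%:E)%E.
  have := @weighted_box_cover R d a b A B (fun=> 1) 1 ler01 (fun=> ler01) (fun i => ltW (ab i)) AB.
  rewrite mul1r => h; apply: le_trans (h _) _ => [x xab|]; last first.
    by rewrite le_eqVlt; apply/orP; left; apply/eqP/eq_eseriesr => j _; rewrite mul1r.
  have [j hj] : exists j, forall i, A j i <= x i <= B j i.
    have [/c1[j _ hj]|/c2[j _ hj]] := sub _ xab.
      by exists j.*2; rewrite /A /B odd_double doubleK.
    by exists j.*2.+1; rewrite /A /B /= odd_double /= uphalf_double.
  apply: le_trans (nneseries_lim_ge j.+1 _); last by move=> i _ _; rewrite lee_fin mulr_ge0.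
  have jx : [forall i, A j i <= x i <= B j i] by exact/forallP.
  rewrite big_nat_recr //= jx mul1r leeDr // sume_ge0 //.
apply/negP; rewrite -ltNge.
(* The first 2n interleaved terms are the first n of each cover. *)
apply: (@le_lt_trans _ _ ((\sum_(0 <= j <oo) (vol A1 B1 j)%:E) + (\sum_(0 <= j <oo) (vol A2 B2 j)%:E))%E).
  apply: lime_le; first by apply: is_cvg_nneseries => j _ _; exact: vol0.
  apply: nearW => n; apply: (@le_trans _ _ (\sum_(0 <= j < n) (vol A1 B1 j)%:E +
      \sum_(0 <= j < n) (vol A2 B2 j)%:E)%E); last first.
    by apply: leeD; apply: nneseries_lim_ge => j _ _; exact: vol0.
  apply: (@le_trans _ _ (\sum_(0 <= j < n.*2) (vol A B j)%:E)%E).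
    have nn : (n <= n.*2)%N by rewrite -addnn leq_addr.
    rewrite (big_cat_nat (leq0n n) nn) /=.
    by rewrite leeDl // sume_ge0 // => j _; exact: vol0.
  rewrite le_eqVlt; apply/orP; left; apply/eqP; elim: n => [|n IH]; first by rewrite !big_nil adde0.
  rewrite doubleS !big_nat_recr //= IH /vol /A /B /= odd_double /= doubleK uphalf_double.
  by rewrite !sumEFin -!EFinD; congr EFin; ring.
by rewrite [v in ltRHS]splitr EFinD; apply: lteD.
Qed.

(** In each coordinate the box extends from [x0] towards the farther face, so boundary points are
    covered too. *)
Lemma box_in_cube x0 (r : R) : unit_cube x0 -> 0 < r <= 2^-1 ->
  exists a b, (forall i, a i < b i) /\ [set x | forall i, a i <= x i <= b i] `<=`
    [set x | unit_cube x /\ forall i, `|x i - x0 i| <= r].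
Proof.
move=> xc /andP[r0 r1].
exists (fun i => if x0 i <= 2^-1 then x0 i else x0 i - r),
  (fun i => if x0 i <= 2^-1 then x0 i + r else x0 i); split=> [i|x hx].
  by case: ifP => _; lra.
by split=> i; have := hx i; have /andP[] := xc i; case: (leP (x0 i) (2^-1));
  rewrite ?ler_norml => h1 h2 h3 /andP[h4 h5]; apply/andP; split; lra.
Qed.

Lemma cexp_near0 (e : R) : 0 < e -> exists2 del : R, 0 < del &
  forall t, `|t| <= del -> Normc.normc (cexp t - 1) <= e.
Proof.
move=> e0; have e2 : 0 < e / 2 by rewrite divr_gt0.
have /cvgrPdist_lt /(_ _ e2) /nbhs_ballP [r1 r10 h1] := @continuous_cos R 0.
have /cvgrPdist_lt /(_ _ e2) /nbhs_ballP [r2 r20 h2] := @continuous_sin R 0.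
pose r := Num.min r1 r2; have r0 : 0 < r by rewrite lt_min; apply/andP; split; [exact: r10|exact: r20].
have pi0 := pi_gt0 R.
exists (r / (4 * pi)) => [|t ht]; first by rewrite divr_gt0 // mulr_gt0.
have ht' : `|2 * pi * t| < r.
  rewrite normrM gtr0_norm ?mulr_gt0 //.
  apply: (@le_lt_trans _ _ (2 * pi * (r / (4 * pi)))); first by rewrite ler_pM2l // mulr_gt0.
  have half (q : R) : 0 < q -> 2 * q * (r / (4 * q)) = r / 2.
    by move=> q0; field; rewrite gt_eqF.
  rewrite half //.
  by rewrite ltr_pdivrMr // mulr_natr mulr2n ltrDl.
have b1 : ball 0 r1 (2 * pi * t) by rewrite /ball /= sub0r normrN (lt_le_trans ht') // ge_min lexx.
have b2 : ball 0 r2 (2 * pi * t) by rewrite /ball /= sub0r normrN (lt_le_trans ht') // ge_min lexx orbT.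
apply: (le_trans (normc_le_ReIm _)).
have := h1 _ b1; have := h2 _ b2; rewrite /= sin0 cos0 sub0r normrN => hs hc.
by rewrite oppr0 addr0 distrC [e]splitr ltW // ltrD.
Qed.

Lemma trigpoly_continuous (I : finType) (k : I -> Zd d) (c : I -> R[i]) x0 (e : R) : 0 < e ->
  exists2 r : R, 0 < r & forall x, (forall i, `|x i - x0 i| <= r) ->
    Normc.normc (trigpoly k c x - trigpoly k c x0) <= e.
Proof.
move=> e0; pose C := \sum_i Normc.normc (c i) + 1.
have C0 : 0 < C by rewrite ltr_wpDl // sumr_ge0 // => i _; exact: normc_ge0.
have [del del0 hdel] := cexp_near0 (divr_gt0 e0 C0).
pose S := \sum_i \sum_t `|(k i t)%:~R : R| + 1.
have S0 : 0 < S by rewrite ltr_wpDl // sumr_ge0 // => i _; rewrite sumr_ge0.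
exists (del / S) => [|x hx]; first by rewrite divr_gt0.
have ekb i : Normc.normc (ek (k i) x - ek (k i) x0) <= e / C.
  have -> : ek (k i) x - ek (k i) x0 = ek (k i) x0 * (cexp (dotk (k i) x - dotk (k i) x0) - 1).
    by rewrite mulrBr mulr1 !ekE -cexpD; congr (cexp _ - _); ring.
  rewrite Normc.normcM ekE normc_cexp mul1r; apply: hdel.
  rewrite /dotk -sumrB (le_trans (ler_norm_sum _ _ _)) //.
  apply: (@le_trans _ _ (\sum_t `|(k i t)%:~R| * (del / S))).
    by apply: ler_sum => t _; rewrite -mulrBr normrM ler_wpM2l.
  rewrite -mulr_suml mulrA ler_pdivrMr // mulrC ler_pM2l //.
  rewrite /S (bigD1 i) //= -addrA lerDl addr_ge0 // sumr_ge0 // => j _.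
  by rewrite sumr_ge0.
rewrite /trigpoly -sumrB; apply: (le_trans (normc_sum _ _ _)).
apply: (@le_trans _ _ (\sum_i Normc.normc (c i) * (e / C))).
  by apply: ler_sum => i _; rewrite -mulrBr Normc.normcM ler_wpM2l ?normc_ge0.
by rewrite -mulr_suml mulrA ler_pdivrMr // mulrC ler_pM2l // lerDl.
Qed.

(** [g] is the common output for f and -f. If |f| > eta at one point, then by continuity on a box;
    there |f - g| + |-f - g| >= 2|f| puts every point into one of the two null sets. *)
Lemma trigpoly_ess_bound (I : finType) (k : I -> Zd d) (c : I -> R[i]) (g : Pt R d -> R[i])
    (M1 M2 : \bar R) (eta : R) :
  (M1 <= eta%:E)%E -> (M2 <= eta%:E)%E ->
  lebesgue_null [set x | unit_cube x /\ (M1 < (Normc.normc (trigpoly k c x - g x))%:E)%E] ->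
  lebesgue_null [set x | unit_cube x /\ (M2 < (Normc.normc (- trigpoly k c x - g x))%:E)%E] ->
  forall x, unit_cube x -> Normc.normc (trigpoly k c x) <= eta.
Proof.
move=> M1e M2e n1 n2 x0 xc; have [//|hx] := leP _ eta; exfalso.
(* Half the excess over [eta], so that |f| > eta persists nearby. *)
pose f := trigpoly k c; pose e := (Normc.normc (f x0) - eta) / 2.
have e0 : 0 < e by rewrite divr_gt0 // subr_gt0.
have [r r0 hr] := trigpoly_continuous k c x0 e0.
have r20 : 0 < Num.min r 2^-1 <= 2^-1 by rewrite lt_min r0 invr_gt0 ltr0n ge_min lexx orbT.
have [a [b [ab box]]] := box_in_cube xc r20.
apply: (null_sets_contain_no_box ab n1 n2) => x /box [xc' xr].
have fx : eta < Normc.normc (f x).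
  have h1 : Normc.normc (f x - f x0) <= e by apply: hr => i; rewrite (le_trans (xr i)) // ge_min lexx.
  have h2 : Normc.normc (f x0) <= Normc.normc (f x) + Normc.normc (f x - f x0).
    rewrite -(normcN (f x - f x0)) (le_trans _ (le_normcD _ _)) //.
    by rewrite opprB addrC subrK.
  rewrite /e in h1 e0; lra.
have : 2 * Normc.normc (f x) <= Normc.normc (f x - g x) + Normc.normc (- f x - g x).
  rewrite -(normcN (- f x - g x)) (le_trans _ (le_normcD _ _)) //.
  have -> : f x - g x + - (- f x - g x) = f x *+ 2.
    by rewrite opprD !opprK addrACA addNr addr0 mulr2n.
  by rewrite normcMn mulr_natl.
have [h|h] := ltP eta (Normc.normc (f x - g x)) => h'.
  by left; split=> //; rewrite (le_lt_trans M1e) ?lte_fin.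
right; split=> //; rewrite (le_lt_trans M2e) ?lte_fin // -/(f x); lra.
Qed.

End NullSets.

(** * Comparison of the minimal errors *)

Section Errors.
Variables (R : realType) (d : nat) (w : Zd d -> R).
Hypothesis w_gt0 : forall t, 0 < w t.

(** The exceptional set is empty and is covered by degenerate boxes; these have volume zero since d
    > 0. *)
Lemma ess_sup_T_le (f : Pt R d -> R) (M : R) : (0 < d)%N ->
  (forall x, unit_cube x -> f x <= M) -> (ess_sup_T f <= M%:E)%E.
Proof.
move=> d0 h; apply: ereal_inf_lbound => eps eps0.
exists (fun _ _ => 0), (fun _ _ => 0); split=> //; split.
  by move=> x [/h]; rewrite lte_fin leNgt => /negbTE ->.
rewrite eseries0 ?lte_fin // => j _ _; congr EFin.
by rewrite (bigD1 (Ordinal d0)) //= subrr mul0r.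
Qed.

Lemma Hnorm2_split (I : finType) (k : I -> Zd d) (c : Coef R d) : injective k ->
  Hnorm2 w c = ((\sum_i sqn (c (k i)) * w (k i) ^+ 2)%:E +
    \esum_(t in ~` range k) (Normc.normc (c t) ^+ 2 * w t ^+ 2)%:E)%E.
Proof.
move=> k_inj; rewrite /Hnorm2 (esum_split k_inj) => [|t]; last first.
  by rewrite lee_fin mulr_ge0 // sqr_ge0.
by rewrite sumEFin; under eq_bigr do rewrite -sqn_normc.
Qed.

Lemma Hnorm2_finite (I : finType) (k : I -> Zd d) (c : Coef R d) : injective k ->
  (forall t, ~ range k t -> c t = 0) ->
  Hnorm2 w c = (\sum_i sqn (c (k i)) * w (k i) ^+ 2)%:E.
Proof.
move=> k_inj c0; rewrite (Hnorm2_split _ k_inj) [X in (_ + X)%E]esum1 ?adde0 // => t /c0 ->.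
by rewrite Normc.normc0 expr0n mul0r.
Qed.

Lemma sum_le_Hnorm2 (I : finType) (k : I -> Zd d) (c : Coef R d) : injective k ->
  Hball w c -> \sum_i sqn (c (k i)) * w (k i) ^+ 2 <= 1.
Proof.
move=> k_inj; rewrite /Hball /= (Hnorm2_split _ k_inj) -lee_fin; apply: le_trans.
by apply: leeDl; apply: esum_ge0 => t _; rewrite lee_fin mulr_ge0 // sqr_ge0.
Qed.

Section Embedding.
Variables (I : finType) (k : I -> Zd d).
Hypothesis k_inj : injective k.

(** Extension by zero off the range of [k], written as a sum over basis vectors so that linear
    functionals expand termwise. *)
Definition embed (c : I -> R[i]) : Coef R d := fun t => \sum_i c i * (k i == t)%:R.

Lemma embedE c i : embed c (k i) = c i.
Proof.
rewrite /embed (bigD1 i) //= eqxx mulr1 big1 ?addr0 // => j ji.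
by rewrite (inj_eq k_inj) (negbTE ji) mulr0.
Qed.

Lemma embed_out c t : ~ range k t -> embed c t = 0.
Proof.
move=> h; rewrite /embed big1 // => i _; case: eqP => [e|]; last by rewrite mulr0.
by case: h; exists i.
Qed.

Lemma Hnorm2_embed c : Hnorm2 w (embed c) = (\sum_i sqn (c i) * w (k i) ^+ 2)%:E.
Proof.
rewrite (Hnorm2_finite k_inj (@embed_out c)).
by under eq_bigr do rewrite embedE.
Qed.

Lemma fval_embed c x : fval (embed c) x = trigpoly k c x.
Proof.
rewrite (fval_finite _ k_inj (@embed_out c)); apply: eq_bigr => i _.
by rewrite /= embedE.
Qed.

Lemma cont_linear_embed (L : Coef R d -> R[i]) (c : I -> R[i]) : is_cont_linear w L ->
  L (embed c) = \sum_i c i * L (embed (fun j => (j == i)%:R)).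
Proof.
move=> [Llin _].
pose e i : Coef R d := fun t => (k i == t)%:R.
have eE i : embed (fun j => (j == i)%:R) = e i.
  apply/funext => t; rewrite /embed (bigD1 i) //= eqxx mul1r big1 ?addr0 // => j /negbTE ->.
  by rewrite mul0r.
have He i : inH w (e i) by rewrite /inH -eE Hnorm2_embed ltry.
under eq_bigr do rewrite eE; rewrite /embed.
suff : inH w (fun t => \sum_i c i * (k i == t)%:R) /\
  L (fun t => \sum_i c i * (k i == t)%:R) = \sum_i c i * L (e i) by case.
elim: (index_enum I) => [|i r [IH1 IH2]].
  have -> : (fun t => \sum_(i <- [::]) c i * (k i == t)%:R) = (fun=> 0 : R[i]).
    by apply/funext => t; rewrite big_nil.
  have H0 : inH w (fun=> 0).
    by rewrite /inH /Hnorm2 esum1 ?ltry // => t _; rewrite Normc.normc0 expr0n mul0r.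
  split=> //; rewrite big_nil.
  (* L(0) = L(0) + L(0) forces L(0) = 0. *)
  have := Llin 1 _ _ H0 H0; rewrite [in LHS](_ : (fun _ : Zd d => 1 * 0 + 0) = (fun=> 0 : R[i])).
    2: by apply/funext => t; rewrite mulr0 addr0.
  rewrite mul1r.
  by move/eqP; rewrite -subr_eq0 opprD addNKr oppr_eq0 => /eqP.
have -> : (fun t => \sum_(j <- i :: r) c j * (k j == t)%:R) =
    (fun t => c i * e i t + \sum_(j <- r) c j * (k j == t)%:R).
  by apply/funext => t; rewrite big_cons.
split; first exact: inH_linear.
by rewrite Llin // big_cons IH2.
Qed.

End Embedding.

(** The strict bound yields an actual algorithm of error below [eta]. It returns the same [g] on the
    whole kernel of its information, in particular for f and -f. *)
Lemma min_err_all_ge (n K : nat) (k : 'I_K -> Zd d) (eta : R) : injective k -> 0 < eta ->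
  (min_err w Lall n < eta%:E)%E ->
  exists G : {set 'I_K}, (#|G| <= n)%N /\ \sum_(i | i \notin G) w (k i) ^- 2 <= eta ^+ 2.
Proof.
move=> k_inj eta0 /ereal_inf_lt [_ [[Ls phi] /= Ladm <-] err].
pose A i t := Ls t (embed k (fun j => (j == i)%:R)).
apply: (@tail_le_of_kernel_bound _ _ _ _ k (w \o k) k_inj (fun i => w_gt0 (k i)) A) => c cA cw x xc.
rewrite sqn_normc ler_pXn2r ?nnegrE ?normc_ge0 ?(ltW eta0) //.
have L0 c' : (forall t, \sum_i c' i * A i t = 0) -> (fun t => Ls t (embed k c')) = (fun=> 0).
  by move=> h; apply/funext => t; rewrite (cont_linear_embed k_inj) ?h //; exact: Ladm.
pose g := phi (fun=> 0).
have bound c' : (forall t, \sum_i c' i * A i t = 0) ->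
    \sum_i sqn (c' i) * w (k i) ^+ 2 <= 1 -> exists2 M : \bar R, (M <= eta%:E)%E &
    lebesgue_null [set x | unit_cube x /\ (M < (Normc.normc (trigpoly k c' x - g x))%:E)%E].
  move=> h0 h1.
  have : (ess_sup_T (fun x => Normc.normc (trigpoly k c' x - g x)%R) < eta%:E)%E.
    apply: le_lt_trans err; apply: ereal_sup_ubound; exists (embed k c').
      by rewrite /Hball /= (Hnorm2_embed k_inj) lee_fin.
    by congr ess_sup_T; apply/funext => y; rewrite (L0 _ h0) (fval_embed k_inj).
  by move=> /ereal_inf_lt [M nM Me]; exists M => //; exact: ltW.
have [M1 M1e n1] := bound _ cA cw.
have [|| M2 M2e n2] := bound (fun i => - c i).
- by move=> t; under eq_bigr do rewrite mulNr; rewrite sumrN cA oppr0.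
- by under eq_bigr do rewrite sqnN.
apply: (trigpoly_ess_bound M1e M2e n1 _ xc); move: n2; congr lebesgue_null.
have tN y : trigpoly k (fun i => - c i) y = - trigpoly k c y.
  by rewrite /trigpoly -sumrN; apply: eq_bigr => i _; rewrite mulNr.
by apply/seteqP; split=> y [yc h]; split=> //; move: h; rewrite tN.
Qed.

Hypothesis w_sum : (\esum_(t in [set: Zd d]) (w t ^- 2)%:E < +oo)%E.

(** Two ball elements with equal samples differ at each point by at most 6 eta from frequencies in
    G, 2 eta from the kept ones off G, and 2 eta from each of the two truncations. *)
Lemma min_err_std_le (n K : nat) (k : 'I_K -> Zd d) (G : {set 'I_K}) (eta : R) :
  (0 < d)%N -> injective k -> 0 < eta ->
  (#|G| <= n)%N -> \sum_(i | i \notin G) w (k i) ^- 2 <= eta ^+ 2 ->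
  (\esum_(t in ~` range k) (w t ^- 2)%:E <= (eta ^+ 2 / n.+1%:R)%:E)%E ->
  (min_err w Lstd (16 * n.+1 ^ 2) <= (12 * eta)%:E)%E.
Proof.
move=> d0 k_inj eta0 cG hG tail; set m := (16 * n.+1 ^ 2)%N.
have N0 : (0 : R) < n.+1%:R by rewrite ltr0n.
have N1 : (1 : R) <= n.+1%:R by rewrite ler1n.
pose rho := eta ^+ 2 / n.+1%:R; have rho0 : 0 < rho by rewrite divr_gt0 // exprn_gt0.
pose del := Num.sqrt rho; have del0 : 0 < del by rewrite sqrtr_gt0.
have del2 : del ^+ 2 = rho by rewrite sqr_sqrtr // ltW.
have del_eta : del <= eta.
  rewrite -(@ler_pXn2r _ 2) ?nnegrE ?(ltW del0) ?(ltW eta0) // del2 /rho ler_pdivrMr //.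
  by rewrite ler_peMr // exprn_ge0 // ltW.
pose wk i := w (k i); have wk0 i : 0 < wk i by exact: w_gt0.
(* Since 1/gam = 1 + rho w^2, the error term of [discretization] becomes the l2 norm plus rho times
   the weighted norm, both squared. *)
pose gam i := (1 + rho * wk i ^+ 2)^-1.
have den0 i : 0 < 1 + rho * wk i ^+ 2 by rewrite ltr_wpDr // mulr_ge0 ?exprn_ge0 // ltW.
have gam0 i : 0 < gam i by rewrite invr_gt0.
have D0 : 0 <= \sum_i gam i by apply: sumr_ge0 => i _; exact: ltW.
(* Terms in G are at most 1; those off G are at most w^-2 / rho, with sum at most eta^2 / rho = n +
   1. *)
have D2 : \sum_i gam i <= 2 * n.+1%:R.
  rewrite (bigID (fun i => i \in G)) /= mulrDl mul1r; apply: lerD.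
    apply: (@le_trans _ _ (\sum_(i in G) 1)).
      by apply: ler_sum => i _; rewrite invf_le1 // lerDl mulr_ge0 ?exprn_ge0 // ltW.
    by rewrite sumr_const ler_nat (leq_trans cG).
  apply: (@le_trans _ _ (\sum_(i | i \notin G) rho^-1 * wk i ^- 2)).
    apply: ler_sum => i _; rewrite -invfM lef_pV2 ?posrE ?mulr_gt0 ?exprn_gt0 //.
    by rewrite lerDr.
  rewrite -mulr_sumr mulrC ler_pdivrMr //; apply: le_trans hG _.
  by rewrite /rho mulrC divfK ?gt_eqF.
have mD : 4 * (\sum_i gam i) ^+ 2 <= m%:R.
  have -> : m%:R = 4 * (2 * n.+1%:R) ^+ 2 :> R by rewrite /m natrM natrX; ring.
  by rewrite ler_pM2l // ler_pXn2r ?nnegrE // mulr_ge0 // ltW.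
have m0 : (0 : R) < m%:R by rewrite ltr0n /m muln_gt0 expn_gt0.
have [p [pc disc]] := discretization k_inj gam0 mD.
have same_data c c' : Hball w c -> Hball w c' ->
    (forall l : 'I_m, fval c (p l) = fval c' (p l)) ->
    forall x, Normc.normc (fval c x - fval c' x) <= 12 * eta.
  move=> cb cb' cc' x.
  pose h i := c (k i) - c' (k i).
  have ap c0 y : Hball w c0 -> Normc.normc (fval c0 y - trigpoly k (c0 \o k) y) <= 2 * del.
    move=> b0; have := @fval_approx R d _ k w c0 y del 1 k_inj w_gt0 w_sum del0 ltr01.
    by rewrite del2 expr1n mulr1; apply.
  have hE y : trigpoly k h y = trigpoly k (c \o k) y - trigpoly k (c' \o k) y.
    by rewrite /trigpoly -sumrB; apply: eq_bigr => i _; rewrite mulrBl.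
  (* The two functions agree at [p l], so only truncation errors remain. *)
  have hp (l : 'I_m) : sqn (trigpoly k h (p l)) <= 16 * rho.
    have -> : trigpoly k h (p l) = - (fval c (p l) - trigpoly k (c \o k) (p l)) +
        (fval c' (p l) - trigpoly k (c' \o k) (p l)) by rewrite hE cc'; ring.
    apply: (le_trans (sqnD_le _ _)); rewrite sqnN !sqn_normc.
    have sq c0 : Hball w c0 ->
        Normc.normc (fval c0 (p l) - trigpoly k (c0 \o k) (p l)) ^+ 2 <= 4 * rho.
      move=> b0; have -> : 4 * rho = (2 * del) ^+ 2 by rewrite exprMn del2; ring.
      by rewrite ler_pXn2r ?nnegrE ?normc_ge0 ?mulr_ge0 ?(ltW del0) //; exact: ap.
    by have := sq _ cb; have := sq _ cb'; lra.
  have hw : \sum_i sqn (h i) * wk i ^+ 2 <= 4.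
    apply: (@le_trans _ _ (\sum_i (2 * (sqn (c (k i)) * wk i ^+ 2) + 2 * (sqn (c' (k i)) * wk i ^+ 2)))).
      apply: ler_sum => i _; rewrite 2!mulrA -mulrDl ler_wpM2r ?sqr_ge0 //.
      by apply: (le_trans (sqnD_le _ _)); rewrite sqnN.
    rewrite big_split /= -!mulr_sumr.
    have := sum_le_Hnorm2 k_inj cb; have := sum_le_Hnorm2 k_inj cb'; rewrite -/wk; lra.
  (* S <= 16 rho + (S + 4 rho)/2, solved for S. *)
  have h2 : \sum_i sqn (h i) <= 36 * rho.
    have := disc h.
    have -> : \sum_i sqn (h i) / gam i = \sum_i sqn (h i) + rho * \sum_i sqn (h i) * wk i ^+ 2.
      by rewrite mulr_sumr -big_split /=; apply: eq_bigr => i _; rewrite /gam invrK; ring.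
    set S := \sum_i sqn (h i); set W := \sum_i sqn (h i) * _ in hw *.
    have : \sum_(l < m) sqn (trigpoly k h (p l)) <= m%:R * (16 * rho).
      rewrite -[m in leRHS]card_ord mulr_natl -sumr_const; apply: ler_sum => l _; exact: hp.
    move=> q1 q2.
    have : m%:R * S <= m%:R * (16 * rho + 2^-1 * (S + rho * W)).
      apply: le_trans q2 _.
      by rewrite [leRHS](_ : _ = m%:R * (16 * rho) + m%:R / 2 * (S + rho * W)) ?lerD2r //; ring.
    rewrite ler_pM2l //; have : rho * W <= rho * 4 by rewrite ler_pM2l.
    lra.
  have young (a b s : R) : 0 < s -> 0 < b -> a <= (s * b ^- 2 + a ^+ 2 * b ^+ 2 / s) / 2.
    move=> s0 b0; rewrite -subr_ge0.
    have -> : (s * b ^- 2 + a ^+ 2 * b ^+ 2 / s) / 2 - a = (a * b - s / b) ^+ 2 / (2 * s).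
      by field; rewrite !gt_eqF.
    by rewrite divr_ge0 ?sqr_ge0 // mulr_ge0 // ltW.
  have hG1 : \sum_(i in G) Normc.normc (h i) <= 6 * eta.
    (* This [s] balances the two Young terms at 3 eta each. *)
    pose s := 6 * eta / n.+1%:R; have s0 : 0 < s by rewrite divr_gt0 // mulr_gt0.
    apply: (@le_trans _ _ (\sum_(i in G) (s / 2 + sqn (h i) * (s^-1 / 2)))).
      apply: ler_sum => i _; apply: (le_trans (young _ 1 s s0 ltr01)).
      by rewrite sqn_normc le_eqVlt; apply/orP; left; apply/eqP; field; rewrite gt_eqF.
    rewrite big_split /= sumr_const -[(s / 2) *+ _]mulr_natl -mulr_suml.
    have s1 : 0 < s / 2 by exact: divr_gt0.
    have s2 : 0 < s^-1 / 2 by rewrite divr_gt0 // invr_gt0.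
    apply: (@le_trans _ _ (n.+1%:R * (s / 2) + 36 * rho * (s^-1 / 2))).
      apply: lerD; first by rewrite ler_pM2r // ler_nat (leq_trans cG).
      rewrite ler_pM2r //; apply: le_trans h2.
      by rewrite [leRHS](bigID (fun i => i \in G)) /= lerDl sumr_ge0 // => i _; exact: sqn_ge0.
    rewrite le_eqVlt; apply/orP; left; apply/eqP; rewrite /s /rho.
    by field; rewrite !gt_eqF.
  have hG2 : \sum_(i | i \notin G) Normc.normc (h i) <= 2 * eta.
    (* Here the two terms balance at eta each. *)
    pose s := 2 / eta; have s0 : 0 < s by rewrite divr_gt0.
    apply: (@le_trans _ _ (\sum_(i | i \notin G)
        (s / 2 * wk i ^- 2 + s^-1 / 2 * (sqn (h i) * wk i ^+ 2)))).
      apply: ler_sum => i _; apply: (le_trans (young _ (wk i) s s0 (wk0 i))).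
      rewrite sqn_normc le_eqVlt; apply/orP; left; apply/eqP.
      by field; rewrite !gt_eqF.
    rewrite big_split /= -!mulr_sumr.
    apply: (@le_trans _ _ (s / 2 * eta ^+ 2 + s^-1 / 2 * 4)).
      have s1 : 0 < s / 2 by exact: divr_gt0.
      have s2 : 0 < s^-1 / 2 by rewrite divr_gt0 // invr_gt0.
      apply: lerD; first by rewrite ler_pM2l.
      rewrite ler_pM2l //; apply: le_trans hw.
      rewrite [leRHS](bigID (fun i => i \notin G)) /= lerDl sumr_ge0 // => i _.
      by rewrite mulr_ge0 ?sqn_ge0 ?exprn_ge0 // ltW.
    rewrite le_eqVlt; apply/orP; left; apply/eqP; rewrite /s.
    by field; rewrite !gt_eqF.
  have -> : fval c x - fval c' x = (fval c x - trigpoly k (c \o k) x) +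
      (trigpoly k h x + - (fval c' x - trigpoly k (c' \o k) x)) by rewrite hE; ring.
  apply: (le_trans (le_normcD _ _)).
  have t1 := ap _ x cb; have t2 := ap _ x cb'.
  have t3 := le_normcD (trigpoly k h x) (- (fval c' x - trigpoly k (c' \o k) x)).
  rewrite normcN in t3.
  have t4 : Normc.normc (trigpoly k h x) <= 8 * eta.
    apply: (le_trans (normc_sum _ _ _)).
    under eq_bigr do rewrite Normc.normcM normc_ek mulr1.
    by rewrite (bigID (fun i => i \in G)) /=; lra.
  lra.
pose data (y : 'I_m -> R[i]) : set (Coef R d) :=
  [set c | Hball w c /\ forall l : 'I_m, fval c (p l) = y l].
(* The output is some ball element with the given samples; the default zero never arises for data of
   a ball element. *)
pose phi (y : 'I_m -> R[i]) := fval (xget (fun=> 0) (data y)).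
pose Ls (l : 'I_m) (c : Coef R d) := fval c (p l).
apply: (@le_trans _ _ (wc_err w Ls phi)).
  by apply: ereal_inf_lbound; exists (Ls, phi) => //= l; exists (p l).
apply: ge_ereal_sup => _ [c cb <-]; apply: ess_sup_T_le => // x _.
have [cb' cc'] : data (Ls^~ c) (xget (fun=> 0) (data (Ls^~ c))) by apply: xgetPex; exists c.
by apply: same_data => // l; rewrite cc'.
Qed.

(** Doubling [eta] supplies the strict inequality that [min_err_all_ge] needs, whence 24 = 12 *
    2. *)
Lemma min_err_std_le_all (n : nat) (eta : R) : (0 < d)%N -> 0 < eta ->
  (min_err w Lall n <= eta%:E)%E ->
  (min_err w Lstd (16 * n.+1 ^ 2) <= (24 * eta)%:E)%E.
Proof.
move=> d0 eta0 h.
have e2 : 0 < 2 * eta by rewrite mulr_gt0.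
have tl0 : 0 < (2 * eta) ^+ 2 / n.+1%:R by rewrite divr_gt0 // exprn_gt0.
have [K [k [k_inj tail]]] := exists_finite_tail w_gt0 w_sum tl0.
have [|G [cG hG]] := @min_err_all_ge n K k (2 * eta) k_inj e2.
  by apply: le_lt_trans h _; rewrite lte_fin ltr_pMl // ltr1n.
have := min_err_std_le d0 k_inj e2 cG hG tail.
by have -> : 12 * (2 * eta) = 24 * eta by ring.
Qed.

Lemma min_err_all_le_std n : (min_err w Lall n <= min_err w Lstd n)%E.
Proof.
apply: ereal_inf_le_tmp => _ [p hp <-]; exists p => // i.
exact: point_eval_cont_linear (hp i).
Qed.

(** The constant function 1/w(0) lies in the ball; an initial error of zero would bound it by half
    its own modulus. *)
Lemma init_err_gt0 : (0 < init_err w)%E.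
Proof.
rewrite ltNge; apply/negP => h.
pose k (_ : 'I_1) : Zd d := 0; have k_inj : injective k by move=> i j _; rewrite !ord1.
pose c (_ : 'I_1) : R[i] := real_complex R (w 0)^-1.
have fE x : trigpoly k c x = c ord0 * ek (k ord0) x by rewrite /trigpoly big_ord1.
have w0 := w_gt0 0; have v0 : 0 < (w 0)^-1 by rewrite invr_gt0.
have nf x : Normc.normc (trigpoly k c x) = (w 0)^-1.
  by rewrite fE Normc.normcM normc_ek mulr1 /c /= expr0n addr0 sqrtr_sqr gtr0_norm.
have : (ess_sup_T (fun x => Normc.normc (trigpoly k c x)) < ((w 0)^-1 / 2)%:E)%E.
  apply: (@le_lt_trans _ _ 0%E); last by rewrite lte_fin divr_gt0.
  apply: le_trans h; apply: ereal_sup_ubound; exists (embed k c).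
    rewrite /Hball /= (Hnorm2_embed k_inj) big_ord1 sqn_real lee_fin exprVn mulVf //.
    by rewrite expf_neq0 // gt_eqF.
  by congr ess_sup_T; apply/funext => x; rewrite (fval_embed k_inj).
move=> /ereal_inf_lt [M nM /ltW Me].
have x0 : unit_cube (fun _ : 'I_d => 0 : R) by move=> i; rewrite lexx ler01.
have := @trigpoly_ess_bound _ _ _ k c (fun=> 0) M M _ Me Me.
rewrite (_ : [set x | _] = [set x | unit_cube x /\ (M < (Normc.normc (trigpoly k c x))%:E)%E]);
  last by apply/seteqP; split=> x; rewrite /= subr0.
move=> /(_ nM); rewrite (_ : [set x | _] = [set x | unit_cube x /\ (M < (Normc.normc (trigpoly k c x))%:E)%E]);
  last by apply/seteqP; split=> x; rewrite /= subr0 normcN.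
by move=> /(_ nM _ x0); rewrite nf; lra.
Qed.

Lemma CRI_gt0 cr : (0 < CRI w cr)%E.
Proof. by case: cr => /=; [rewrite lte_fin | exact: init_err_gt0]. Qed.

Lemma nstar_all_le_std cr eps : (nstar w Lall cr eps <= nstar w Lstd cr eps)%E.
Proof.
apply: ereal_inf_le_tmp => _ [n hn <-]; exists n => //.
exact: le_trans (min_err_all_le_std n) hn.
Qed.

Lemma nstar_std_le cr (eps B : R) : (0 < d)%N -> 0 < eps ->
  (nstar w Lall cr (eps / 24) <= B%:E)%E ->
  (nstar w Lstd cr eps <= (16 * (B + 2) ^+ 2)%:E)%E.
Proof.
move=> d0 eps0 hB.
(* The slack 1 gives an actual [n] in the set, with n + 1 < B + 2. *)
have : (nstar w Lall cr (eps / 24) < (B + 1)%:E)%E.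
  by apply: le_lt_trans hB _; rewrite lte_fin ltrDl.
move=> /ereal_inf_lt [_ [n hn <-]]; rewrite lte_fin => nB.
apply: (@le_trans _ _ ((16 * n.+1 ^ 2)%N%:R)%:E).
  apply: ereal_inf_lbound; exists (16 * n.+1 ^ 2)%N => //.
  move: hn; rewrite /=; have := CRI_gt0 cr; case: (CRI w cr) => [r|_ _|//].
    rewrite lte_fin => r0 hn.
    have := min_err_std_le_all d0 (_ : 0 < eps / 24 * r) hn.
    rewrite (_ : 24 * (eps / 24 * r) = eps * r); last by field.
    by apply; rewrite mulr_gt0 // divr_gt0.
  (* An infinite reference error makes the error demand void. *)
  by rewrite gt0_muley ?lte_fin // leey.
rewrite lee_fin natrM natrX ler_pM2l // ler_pXn2r ?nnegrE //.
  by rewrite -natr1; lra.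
by have : (0 : R) <= n%:R by []; lra.
Qed.

End Errors.

(** * From minimal errors to EXP-QPT *)

(** The logarithm of ln(s/eps) + 1 <= (1 + ln s)(1 + ln(1/eps)), combined with 1 + a + b <= (1 +
    a)(1 + b) for a, b >= 0. *)
Lemma ln_ln_scaled (R : realType) (eps s : R) : 0 < eps < 1 -> 1 < s ->
  1 + ln (ln (eps / s)^-1 + 1) <= (1 + ln (1 + ln s)) * (1 + ln (ln eps^-1 + 1)).
Proof.
move=> /andP[eps0 eps1] s1; have s0 : 0 < s by rewrite (lt_trans ltr01).
have ls : 0 < ln s by exact: ln_gt0.
have le : 0 < ln eps^-1 by rewrite ln_gt0 // invf_gt1.
have lls : 0 <= ln (1 + ln s) by rewrite ln_ge0 // lerDl ltW.
have lle : 0 <= ln (ln eps^-1 + 1) by rewrite ln_ge0 // lerDr ltW.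
have p1 : 0 < 1 + ln s by rewrite addr_gt0.
have p2 : 0 < ln eps^-1 + 1 by rewrite addr_gt0.
have e : ln (eps / s)^-1 = ln s + ln eps^-1.
  by rewrite invf_div lnM ?posrE ?invr_gt0.
have step : ln (ln (eps / s)^-1 + 1) <= ln (1 + ln s) + ln (ln eps^-1 + 1).
  rewrite e -[leRHS]lnM ?posrE // ler_ln ?posrE ?mulr_gt0 //; last by rewrite -addrA addr_gt0.
  nra.
nra.
Qed.

Theorem theorem4p2 (R : realType) (w : forall d : nat, Zd d -> R)
  (w_pos : forall (d : nat) (k : Zd d), 0 < w d k)
  (w_sum : forall d : nat, (\esum_(k in [set: Zd d]) ((w d k) ^-2)%:E < +oo)%E)
  (cr : criterion) :
  EXP_QPT w Lall cr <-> EXP_QPT w Lstd cr.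
Proof.
split=> [[C [t [C0 [t0 h]]]]|[C [t [C0 [t0 h]]]]]; last first.
  exists C, t; split=> //; split=> // d d0 eps heps.
  exact: le_trans (nstar_all_le_std (w_pos d) (w_sum d) cr eps) (h d d0 eps heps).
have l24 : (0 : R) < ln 24 by rewrite ln_gt0 // ltr1n.
(* The price in the exponent of replacing eps by eps/24. *)
pose K : R := 1 + ln (1 + ln 24).
have K0 : 0 <= K by rewrite addr_ge0 // ln_ge0 // lerDl ltW.
(* As E >= 1, C E + 2 <= (C + 2) E; squaring doubles the exponent. *)
exists (16 * (C + 2) ^+ 2), (2 * t * K); split; first by rewrite mulr_gt0 // exprn_gt0 // addr_gt0.
split=> [|d d0 eps /andP[eps0 eps1]]; first by rewrite mulr_ge0 // mulr_ge0.
have heps : 0 < eps / 24 < 1 by rewrite divr_gt0 //=; lra.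
apply: (le_trans (nstar_std_le (w_pos d) (w_sum d) d0 eps0 (h d d0 _ heps))).
set A := 1 + ln d%:R; have A0 : 0 <= A by rewrite addr_ge0 // ln_ge0 // ler1n.
have := @ln_ln_scaled R eps 24; rewrite eps0 eps1 ltr1n => /(_ isT isT).
set B' := 1 + ln (ln (eps / 24)^-1 + 1); set B := 1 + ln (ln eps^-1 + 1) => BB.
have B'0 : 0 <= B'.
  rewrite addr_ge0 // ln_ge0 // lerDr ln_ge0 // invf_ge1; lra.
set E := expR (t * A * B'); have E1 : 1 <= E by rewrite -expR0 ler_expR !mulr_ge0.
have E2 : E ^+ 2 <= expR (2 * t * K * A * B).
  rewrite -expRM_natl ler_expR.
  have -> : 2 * t * K * A * B = 2 * (t * A * (K * B)) by ring.
  by rewrite ler_pM2l // ler_wpM2l // mulr_ge0.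
rewrite lee_fin -mulrA ler_pM2l //.
apply: (@le_trans _ _ (((C + 2) * E) ^+ 2)); last by rewrite exprMn ler_wpM2l // sqr_ge0.
have CE : 0 <= C * E by rewrite mulr_ge0 ?expR_ge0 // ltW.
by rewrite mulrDl ler_pXn2r ?nnegrE //; lra.
Qed.
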